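(* Let $F(x,y,z)$ be an irreducible polynomial defining an affine rotation surface $S$ about an axis $\mathcal{A}$. Let $\boldsymbol{P}=(x,y,z)$ be an arbitrary point in $\mathbb{R}^3$, denote the Plücker coordinates of $\mathcal{A}$ by $(\beta,\alpha)$, where $\alpha=(\alpha_1,\alpha_2,\alpha_3)$ and $\beta=(\beta_1,\beta_2,\beta_3)$, and let $\gamma=(\gamma_1,\gamma_2,\gamma_3)$ be the vector of rational functions of $x,y,z$ giving the direction of the affine normals of the level surfaces of $F$. Then, identically in $x,y,z$, $$\alpha\cdot(\boldsymbol{P}\times\gamma)+\beta\cdot\gamma=\alpha_1(y\gamma_3-z\gamma_2)+\alpha_2(-x\gamma_3+z\gamma_1)+\alpha_3(x\gamma_2-y\gamma_1)+\beta_1\gamma_1+\beta_2\gamma_2+\beta_3\gamma_3\equiv0.$$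
   Context: Standing assumptions: $S$ is the zero set in $\mathbb{R}^3$ of the irreducible real polynomial $F$, the real part of $S$ is 2-dimensional, and the Gaussian curvature of $S$ is not identically zero. Canonical affine rotation groups about the $z$-axis (parameter $\alpha\in\mathbb{R}$): elliptic $\begin{pmatrix}\cos\alpha&-\sin\alpha&0\\ \sin\alpha&\cos\alpha&0\\0&0&1\end{pmatrix}$, hyperbolic $\begin{pmatrix}\cosh\alpha&\sinh\alpha&0\\ \sinh\alpha&\cosh\alpha&0\\0&0&1\end{pmatrix}$, parabolic $\begin{pmatrix}1&0&0\\ \alpha&1&0\\ \alpha^2/2&\alpha&1\end{pmatrix}$. $S$ is an affine rotation surface about a line $\mathcal{A}$ (its axis) if there is a rigid motion $T$ of $\mathbb{R}^3$ carrying $\mathcal{A}$ to the $z$-axis such that $T(S)$ is invariant under one of these three groups. Plücker coordinates: a line through a point $Q$ (identified with its position vector) with direction vector $\mathbf{w}\ne0$ has Plücker coordinates $(\bar{\mathbf{w}},\mathbf{w})\in\mathbb{R}^6$ with $\bar{\mathbf{w}}=Q\times\mathbf{w}$ (unique up to a nonzero constant). Thus $\alpha$ is a direction vector of $\mathcal{A}$ and $\beta=Q\times\alpha$ for $Q\in\mathcal{A}$. Affine normal: for a local parametrization $\mathbf{x}(u,v)$ of a surface with unit Euclidean normal $\mathbf{N}$ and Gaussian curvature $K\neq0$, the affine co-normal is $\nu=|K|^{-1/4}\mathbf{N}$ and the affine normal vector is $\xi=[\nu,\nu_u,\nu_v]^{-1}(\nu_u\times\nu_v)$, with $[\cdot,\cdot,\cdot]$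 the determinant. For surfaces given implicitly through $F$, the affine normal vector at a generic point $(x,y,z)$ has an expression, depending only on $F$ through its partial derivatives, of the form $\xi(x,y,z)=a(x,y,z)\,(\gamma_1,\gamma_2,\gamma_3)$, where $a$ is a nonzero scalar function involving a radical and $\gamma_1,\gamma_2,\gamma_3$ are rational functions of $x,y,z$; so at a generic point $(x,y,z)\in\mathbb{R}^3$, $\gamma(x,y,z)$ is a direction vector of the affine normal line at that point to the level surface of $F$ through it. *)

(* Defs.v *)
From HB Require Import structures.
From mathcomp Require Import all_boot all_order all_algebra.
From mathcomp Require Import all_classical all_reals all_analysis.
From mathcomp.multinomials Require mpoly.
(* The notations of mpoly clash with those of MathComp-Analysis. *)
Export -(notations) mpoly.

Set Implicit Arguments.
Unset Strict Implicit.
Unset Printing Implicit Defensive.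

Import Order.TTheory GRing.Theory Num.Theory.
Export numFieldNormedType.Exports.

Local Open Scope classical_set_scope.
Local Open Scope ring_scope.

Section Vectors.
Variable K : comNzRingType.
Implicit Types u v w : 'cV[K]_3.

Definition vec3 (a b c : K) : 'cV[K]_3 := \col_i nth 0 [:: a; b; c] i.

Definition mat3 (rows : seq (seq K)) : 'M[K]_3 :=
  \matrix_(i, j) nth 0 (nth [::] rows i) j.

Definition dot u v : K := \sum_(i < 3) u i 0 * v i 0.

Definition cross u v : 'cV[K]_3 :=
  vec3 (u 1 0 * v 2 0 - u 2 0 * v 1 0)
       (u 2 0 * v 0 0 - u 0 0 * v 2 0)
       (u 0 0 * v 1 0 - u 1 0 * v 0 0).

Definition det3 u v w : K := \det (row_mx u (row_mx v w)).

End Vectors.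

Definition irreducible_elt (A : idomainType) (p : A) : Prop :=
  [/\ p != 0, p \isn't a GRing.unit &
      forall q r : A, p = q * r -> q \is a GRing.unit \/ r \is a GRing.unit].

Section Surfaces.
Variable R : realType.
Local Notation point := 'cV[R]_3.

Definition enorm (u : point) : R := Num.sqrt (dot u u).

Section Parametrizations.

Definition Du (V : normedModType R) (f : R * R -> V) (p : R * R) : V :=
  'D_((1, 0) : R * R) f p.
Definition Dv (V : normedModType R) (f : R * R -> V) (p : R * R) : V :=
  'D_((0, 1) : R * R) f p.

Fixpoint class_C (V : normedModType R) (k : nat) (U : set (R * R))
    (f : R * R -> V) : Prop :=
  (forall p, U p -> {for p, continuous f}) /\
  if k is k'.+1 then
    [/\ forall p, U p ->
          derivable f p ((1, 0) : R * R) /\ derivable f p ((0, 1) : R * R),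
        class_C k' U (Du f) & class_C k' U (Dv f)]
  else True.

(* The affine normal vector involves third derivatives of the
   parametrization, hence the class C^3. *)
Definition regular_param (U : set (R * R)) (x : R * R -> point) : Prop :=
  [/\ open U, class_C 3 U x &
      forall p, U p -> cross (Du x p) (Dv x p) != 0].

Variable x : R * R -> point.

Definition unit_normal (p : R * R) : point :=
  (enorm (cross (Du x p) (Dv x p)))^-1 *: cross (Du x p) (Dv x p).

Definition gauss_curvature (p : R * R) : R :=
  let E := dot (Du x p) (Du x p) in
  let F := dot (Du x p) (Dv x p) in
  let G := dot (Dv x p) (Dv x p) in
  let L := dot (unit_normal p) (Du (Du x) p) in
  let M := dot (unit_normal p) (Dv (Du x) p) in
  let N := dot (unit_normal p) (Dv (Dv x) p) in
  (L * N - M ^+ 2) / (E * G - F ^+ 2).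

Definition affine_conormal (p : R * R) : point :=
  (`|gauss_curvature p| `^ (- 4^-1)) *: unit_normal p.

Definition affine_normal (p : R * R) : point :=
  let nu := affine_conormal in
  (det3 (nu p) (Du nu p) (Dv nu p))^-1 *: cross (Du nu p) (Dv nu p).

End Parametrizations.

(* Dimension exactly 2: S contains a piece of regular surface, but no open
   ball of R^3. *)
Definition two_dimensional (S : set point) : Prop :=
  (exists U x, [/\ regular_param U x, U !=set0 & x @` U `<=` S]) /\
  interior S = set0.

Definition curvature_not_identically_zero (S : set point) : Prop :=
  exists U x p,
    [/\ regular_param U x, x @` U `<=` S, U p & gauss_curvature x p != 0].

(* xi is the affine normal vector at P of a surface contained in S, through a
   local parametrization around P; xi is determined up to sign when S is a
   smooth surface near P. *)
Definition is_affine_normal (S : set point) (P xi : point) : Prop :=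
  exists U x p,
    [/\ regular_param U x, x @` U `<=` S,
        forall q, U q -> gauss_curvature x q != 0,
        U p /\ x p = P & xi = affine_normal x p].

Definition line (Q w : point) : set point := [set Q + t *: w | t in setT].

Definition z_axis : set point := line 0 (vec3 0 0 1).

Definition plucker (A : set point) (b a : point) : Prop :=
  a != 0 /\ exists Q, A = line Q a /\ b = cross Q a.

Definition rigid_motion (T : point -> point) : Prop :=
  exists (M : 'M[R]_3) (b : point),
    M^T *m M = 1%:M /\ forall P, T P = M *m P + b.

Definition cosh (t : R) : R := (expR t + expR (- t)) / 2.
Definition sinh (t : R) : R := (expR t - expR (- t)) / 2.

Definition elliptic (t : R) : 'M[R]_3 :=
  mat3 [:: [:: cos t; - sin t; 0]; [:: sin t; cos t; 0]; [:: 0; 0; 1]].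

Definition hyperbolic (t : R) : 'M[R]_3 :=
  mat3 [:: [:: cosh t; sinh t; 0]; [:: sinh t; cosh t; 0]; [:: 0; 0; 1]].

Definition parabolic (t : R) : 'M[R]_3 :=
  mat3 [:: [:: 1; 0; 0]; [:: t; 1; 0]; [:: t ^+ 2 / 2; t; 1]].

Definition invariant_under (G : R -> 'M[R]_3) (S : set point) : Prop :=
  forall t : R, mulmx (G t) @` S = S.

Definition affine_rotation_surface (S A : set point) : Prop :=
  exists T : point -> point,
    [/\ rigid_motion T, T @` A = z_axis &
        [\/ invariant_under elliptic (T @` S),
            invariant_under hyperbolic (T @` S) |
            invariant_under parabolic (T @` S)]].

Local Notation poly3 := (mpoly 3 R).
Local Notation ratfun := {fraction poly3}.

Definition peval (p : poly3) (P : point) : R := meval (fun i => P i 0) p.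

Definition zero_set (F : poly3) : set point := [set P | peval F P = 0].

Definition level_surface (F : poly3) (P : point) : set point :=
  [set Q | peval F Q = peval F P].

(* The rational function f is defined at P, with value c. *)
Definition rat_value (f : ratfun) (P : point) (c : R) : Prop :=
  exists p q : poly3,
    [/\ f = tofrac p / tofrac q, peval q P != 0 & c = peval p P / peval q P].

(* A property holds at a generic point when it holds outside the zero set of
   a nonzero polynomial. *)
Definition generically (H : point -> Prop) : Prop :=
  exists D : poly3, D != 0 /\ forall P, peval D P != 0 -> H P.

Definition affine_normal_direction (F : poly3) (g : 'cV[ratfun]_3) : Prop :=
  generically (fun P =>
    exists (xi gP : point) (a : R),
      [/\ is_affine_normal (level_surface F P) P xi,
          forall i, rat_value (g i 0) P (gP i 0),
          a != 0 & xi = a *: gP]).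

Definition xyz : 'cV[ratfun]_3 := \col_i tofrac (mpolyX R (mnm1 i)).

Definition const_vec (v : point) : 'cV[ratfun]_3 :=
  \col_i tofrac (mpolyC 3 (v i 0)).

End Surfaces.

(* Main.v *)
Require Import Defs.
From mathcomp Require Import all_boot all_order all_algebra.
From mathcomp Require Import all_classical all_reals all_analysis.
From mathcomp Require Import ring lra zify.

(** Let [Q] be a point of the axis, [V P = C (P - Q)] the vector field that
    generates the rotation group, [n] and [H] the gradient and the Hessian of
    [F]. The matrix [C] is traceless and its kernel is the direction [alpha] of
    the axis. The identity to prove says that [alpha], [P - Q] and the affine
    normal at [P] are coplanar.

    Every level surface of [F], and not only the zero set, is invariant. As [V]
    is tangent to the zero set [S], the polynomial [n . V] vanishes on [S], and
    then the irreducible [F] divides it, because [S] contains a piece of surface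
    ([irreducible_divides]: an elimination that rests on Gauss's lemma would
    otherwise confine that piece to a cylinder over a plane curve). Comparing
    degrees, [n . V = lambda F] with [lambda] constant. Then [F] is multiplied
    by [exp (lambda t)] along the orbits, which are periodic in the elliptic
    case and polynomial in [t] in the parabolic case, so that [lambda = 0]. In
    the hyperbolic case a nonzero [lambda] forces [F] to vanish on a plane, so
    that [S] is a plane, against the hypothesis on the curvature
    ([invariant_polynomial]).

    On a level surface the Gaussian curvature is [B / |n|^4], where
    [B = n^T adj(H) n] is a polynomial, and the affine conormal is
    [|B|^(-1/4) n] up to sign. From [n . V = 0] one gets [H V = - C^T n], and
    [B] is constant along [V] since [C] is traceless ([lie_curvature_poly]).
    Hence the derivative of the conormal along [V] is a nonzero multiple of
    [C^T n]. The affine normal is orthogonal to the derivatives of the conormal,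
    in particular to [C^T n]. But [C^T n] is also orthogonal to [alpha], because
    [C alpha = 0], and to [P - Q], because [n . V = 0]. This gives coplanarity
    when [C^T n] is nonzero. When it is zero, [H V = 0] with [V] tangent, which
    at a point of nonzero curvature implies [V = 0], so that [P] is on the axis
    ([affine_normal_meets_axis]).

    The identity thus holds at a generic point, and both sides are rational
    functions. *)

Set Implicit Arguments.
Unset Strict Implicit.
Unset Printing Implicit Defensive.

Import Order.TTheory GRing.Theory Num.Theory.

Local Open Scope classical_set_scope.
Local Open Scope ring_scope.
Import Pdiv.Idomain.

(** * Factorial rings and Gauss's lemma *)

Section Factorial.
Variable A : idomainType.

Definition factor_norm (N : A -> nat) : Prop :=
  (forall a b : A, a != 0 -> b != 0 -> N (a * b) = (N a + N b)%N) /\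
  (forall a : A, a != 0 -> N a = 0%N -> a \is a GRing.unit).

Definition divides (a b : A) : Prop := exists c : A, b = a * c.

(** Unique factorization, in the form that passes most directly to polynomial
    rings: an additive norm replaces the ascending chain condition. *)
Definition factorial_ring : Prop :=
  (exists N, factor_norm N) /\
  (forall p a b : A, irreducible_elt p -> divides p (a * b) ->
     divides p a \/ divides p b).

Lemma irreducible_factor (N : A -> nat) (a : A) :
  factor_norm N -> a != 0 -> a \isn't a GRing.unit ->
  exists p b, irreducible_elt p /\ a = p * b.
Proof.
move=> [NM N0]; have [n] := ubnP (N a).
elim: n a => // n IHn a ltNa a0 aNu.
have [irr_a|] := pselect (irreducible_elt a).
  by exists a, 1; rewrite mulr1.
move=> nirr; have [q [r [aqr [qNu rNu]]]] : exists q r : A,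
    a = q * r /\ q \isn't a GRing.unit /\ r \isn't a GRing.unit.
  apply: contrapT => nex; apply: nirr; split=> // q r aqr.
  case: (boolP (q \is a GRing.unit)) => [|qNu]; first by left.
  case: (boolP (r \is a GRing.unit)) => [|rNu]; first by right.
  by case: nex; exists q, r.
have /norP[q0 r0] : ~~ ((q == 0) || (r == 0)) by rewrite -mulf_eq0 -aqr.
have Nr : (0 < N r)%N.
  by rewrite lt0n; apply: contra rNu => /eqP; exact: N0.
have [p [b [irr_p qE]]] : exists p b, irreducible_elt p /\ q = p * b.
  apply: IHn => //; rewrite -ltnS; apply: leq_trans ltNa.
  by rewrite aqr NM// !ltnS -addn1 leq_add2l.
by exists p, (b * r); rewrite aqr qE mulrA.
Qed.

Lemma divides_sub (a b c : A) :
  divides a b -> divides a c -> divides a (b - c).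
Proof. by move=> [u ->] [v ->]; exists (u - v); rewrite mulrBr. Qed.

Lemma divides_mulr (a b c : A) : divides a b -> divides a (b * c).
Proof. by move=> [u ->]; exists (u * c); rewrite mulrA. Qed.

End Factorial.

Section GaussLemma.
Variable A : idomainType.
Hypothesis A_fact : factorial_ring A.
Implicit Types f g h : {poly A}.

Lemma divides_polyC (p : A) f :
  divides p%:P f <-> forall i, divides p f`_i.
Proof.
split=> [[g ->] i|pf]; first by exists g`_i; rewrite coefCM.
have [c fE] := choice pf.
exists (\poly_(i < size f) c i); apply/polyP => i.
rewrite coefCM coef_poly; case: ltnP => [_|le_fi]; first exact: fE.
by rewrite mulr0 nth_default.
Qed.

(** Strip the leading terms: [p] divides the leading coefficient of [f] or of
    [g], and the corresponding term can be removed. *)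
Lemma irreducible_polyC_prime (p : A) f g : irreducible_elt p ->
  divides p%:P (f * g) -> divides p%:P f \/ divides p%:P g.
Proof.
move=> irr_p; have [n] := ubnP (size f + size g)%N.
have step u v : u != 0 -> divides p (lead_coef u) -> divides p%:P (u * v) ->
    exists2 u' : {poly A}, (size u' < size u)%N & divides p%:P (u - u') /\
      divides p%:P (u' * v).
  move=> u0 [c lu] puv; set t := (p * c) *: 'X^((size u).-1).
  have pt : divides p%:P t.
    by exists (c *: 'X^((size u).-1)); rewrite /t -scalerA mul_polyC.
  exists (u - t).
    rewrite /t -lu -(prednK (n := size u)) ?size_poly_gt0// ltnS.
    apply/leq_sizeP => j lej; rewrite coefB coefZ coefXn.
    move: lej; rewrite leq_eqVlt => /predU1P[<-|ltj].
      by rewrite eqxx mulr1 -lead_coefE subrr.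
    rewrite gtn_eqF// mulr0 subr0 nth_default//.
    by rewrite -(prednK (n := size u)) ?size_poly_gt0.
  split; first by rewrite opprB addrC subrK.
  by rewrite mulrBl; apply: divides_sub => //; exact: divides_mulr.
elim: n f g => // n IHn f g ltn pfg.
have [->|f0] := eqVneq f 0; first by left; exists 0; rewrite mulr0.
have [->|g0] := eqVneq g 0; first by right; exists 0; rewrite mulr0.
have : divides p (lead_coef f * lead_coef g).
  by rewrite -lead_coefM lead_coefE; apply: (divides_polyC p (f * g)).1.
case/(A_fact.2 _ _ _ irr_p) => plc.
- have [f' ltf [pff' pf'g]] := step f g f0 plc pfg.
  have [| |] := IHn f' g _ pf'g; last by right.
    by rewrite -ltnS; apply: leq_trans ltn; rewrite ltnS ltn_add2r.
  move=> [c f'E]; left; case: pff' => d fE; exists (d + c).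
  by rewrite mulrDr -fE -f'E subrK.
- have pgf : divides p%:P (g * f) by rewrite mulrC.
  have [g' ltg [pgg' pg'f]] := step g f g0 plc pgf.
  rewrite mulrC in pg'f; have [| |[c g'E]] := IHn f g' _ pg'f; last 1 first.
  + right; case: pgg' => d gE; exists (d + c).
    by rewrite mulrDr -gE -g'E subrK.
  + by rewrite -ltnS; apply: leq_trans ltn; rewrite ltnS ltn_add2l.
  + by left.
Qed.

(** Denominators can be cleared on each factor separately: the form of
    Gauss's lemma that serves for elimination and for factoriality alike. *)
Lemma split_constant_factor (c : A) f g h : c != 0 -> c%:P * f = g * h ->
  exists c1 c2 g' h', [/\ c1 != 0, c2 != 0, g = c1%:P * g',
    h = c2%:P * h' & f = g' * h'].
Proof.
have [[N [NM N0]] _] := A_fact.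
have [n] := ubnP (N c); elim: n c f g h => // n IHn c f g h ltc c0 cf.
case: (boolP (c \is a GRing.unit)) => [cu|cNu].
  exists c, 1, (c^-1%:P * g), h; split; rewrite ?oner_eq0 ?mul1r//.
    by rewrite mulrA -polyCM divrr// mul1r.
  by rewrite -mulrA -cf mulrA -polyCM mulVr// mul1r.
have [p [b [irr_p cE]]] := irreducible_factor (conj NM N0) c0 cNu.
have [p0 pNu _] := irr_p.
have b0 : b != 0 by apply: contra_neq c0; rewrite cE => ->; rewrite mulr0.
have ltb : (N b < n)%N.
  rewrite -ltnS; apply: leq_trans ltc; rewrite cE NM// ltnS -addn1 addnC.
  by rewrite leq_add2r lt0n; apply: contra pNu => /eqP; exact: N0.
have pP0 : p%:P != 0 by rewrite polyC_eq0.
have : divides p%:P (g * h).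
  by exists (b%:P * f); rewrite -cf cE polyCM mulrA.
case/(irreducible_polyC_prime irr_p) => [[g1 gE]|[h1 hE]].
- have : b%:P * f = g1 * h.
    by apply: (mulfI pP0); rewrite !mulrA -polyCM -cE cf gE.
  case/(IHn _ _ _ _ ltb b0) => c1 [c2 [g' [h' [c10 c20 g1E hE fE]]]].
  exists (p * c1), c2, g', h'; split=> //; first by rewrite mulf_neq0.
  by rewrite gE g1E polyCM mulrA.
- have : b%:P * f = g * h1.
    by apply: (mulfI pP0); rewrite !mulrA -polyCM -cE cf hE mulrCA mulrA.
  case/(IHn _ _ _ _ ltb b0) => c1 [c2 [g' [h' [c10 c20 gE h1E fE]]]].
  exists c1, (p * c2), g', h'; split=> //; first by rewrite mulf_neq0.
  by rewrite hE h1E polyCM mulrA.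
Qed.

(** The relation [%|] is divisibility up to a nonzero constant of [A], that is,
    over the fraction field. *)
Lemma irreducible_dvdp f g : irreducible_elt f -> (1 < size f)%N ->
  f %| g -> divides f g.
Proof.
move=> [f0 fNu irr_f] sf /dvdpP[[c h] /= c0]; rewrite -mul_polyC => cgE.
have [c1 [c2 [h' [f' [_ c20 _ fE gE]]]]] := split_constant_factor c0 cgE.
case: (irr_f _ _ fE) => u.
  by exists (c2%:P^-1 * h'); rewrite mulrA {1}fE (mulrC c2%:P) mulrK// mulrC.
suff : (size f <= 1)%N by rewrite leqNgt sf.
move: u; rewrite poly_unitE => /andP[/eqP sf' _].
by rewrite fE mul_polyC (leq_trans (size_scale_leq _ _))// sf'.
Qed.

Lemma irreducible_coprimep f g : irreducible_elt f -> (1 < size f)%N ->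
  f %| g \/ coprimep f g.
Proof.
move=> [f0 fNu irr_f] sf; set d := gcdp f g.
have /dvdpP[[c h] /= c0] : d %| f by rewrite dvdp_gcdl.
rewrite -mul_polyC => cfE.
have [c1 [c2 [h' [d' [c10 c20 hE dE fE]]]]] := split_constant_factor c0 cfE.
case: (irr_f _ _ fE) => u; last first.
  right; rewrite coprimep_def -/d dE mul_polyC size_scale//.
  by move: u; rewrite poly_unitE => /andP[].
left; apply: (@dvdp_trans _ d); last by rewrite dvdp_gcdr.
apply/dvdpP; exists (1, c2%:P * h'^-1); rewrite /= ?oner_eq0// scale1r.
by rewrite dE fE -mulrA mulKr.
Qed.

(** Elimination of the main variable: a Bezout relation over the fraction field,
    without its denominators. *)
Lemma irreducible_elimination f g : irreducible_elt f -> (1 < size f)%N ->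
  ~ divides f g -> exists u v (c : A), c != 0 /\ u * f + v * g = c%:P.
Proof.
move=> irr_f sf ndvd; case: (irreducible_coprimep g irr_f sf) => [fg|].
  by case: ndvd; exact: irreducible_dvdp.
case/Bezout_coprimepP => -[u v] /=; rewrite -size_poly_eq1.
by case/size_poly1P => c c0 uvE; exists u, v, c.
Qed.

(** The norm of a polynomial adds its degree to the norm of its leading
    coefficient. *)
Lemma factorial_ring_poly : factorial_ring {poly A}.
Proof.
have [[N [NM N0]] A_prime] := A_fact; split.
  exists (fun f => ((size f).-1 + N (lead_coef f))%N); split=> [f g f0 g0|f f0].
    rewrite lead_coefM NM ?lead_coef_eq0// size_mul//.
    rewrite -(prednK (n := size f)) ?size_poly_gt0//.
    by rewrite -(prednK (n := size g)) ?size_poly_gt0// addSn addnS/= addnACA.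
  move/eqP; rewrite addn_eq0 => /andP[/eqP sf /eqP Nf].
  have sf1 : size f == 1%N.
    by rewrite -(prednK (n := size f)) ?size_poly_gt0// sf.
  rewrite poly_unitE sf1/=; move: Nf; rewrite lead_coefE sf.
  apply: N0; rewrite -[f`_0]/(f`_(1.-1)) -(eqP sf1) -lead_coefE.
  by rewrite lead_coef_eq0.
move=> f g h irr_f; have [f0 fNu fI] := irr_f.
have [sf|sf] := ltnP 1 (size f).
  move=> [k ghE]; case: (irreducible_coprimep g irr_f sf) => [fg|cop].
    by left; exact: irreducible_dvdp.
  right; apply: irreducible_dvdp => //; rewrite -(Gauss_dvdpr _ cop).
  by rewrite ghE dvdp_mulr.
have fE := size1_polyC sf; move: (f`_0) fE => c fE; subst f.
apply: irreducible_polyC_prime; split=> [||q r cE].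
- by rewrite -polyC_eq0.
- by apply: contra fNu => cu; exact: rmorph_unit.
- have [] := fI q%:P r%:P; rewrite ?cE ?polyCM//.
    by rewrite poly_unitE coefC eqxx => /andP[_]; left.
  by rewrite poly_unitE coefC eqxx => /andP[_]; right.
Qed.

End GaussLemma.

Lemma factorial_field (K : fieldType) : factorial_ring K.
Proof.
split; first by exists (fun=> 0%N); split=> // a a0 _; rewrite unitfE.
by move=> p a b [p0]; rewrite unitfE p0.
Qed.

(** * Polynomials in three variables *)

Section RingInduction.
Variables (n : nat) (R : nzRingType).

Lemma mpoly_ring_ind (P : mpoly n R -> Prop) :
  (forall c, P (mpolyC n c)) -> (forall i, P (mpolyX R (mnm1 i))) ->
  (forall p q, P p -> P q -> P (p + q)) ->
  (forall p q, P p -> P q -> P (p * q)) -> forall p, P p.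
Proof.
move=> PC PX PD PM; elim/mpolyind => [|c m p _ _ Pp].
  by rewrite -(mpolyC0 n R); exact: PC.
apply: (PD) => //; rewrite -mul_mpolyC; apply: (PM); first exact: PC.
rewrite mpolyXE_id; apply: (big_ind P) => [|p' q'|i _].
- by rewrite -mpolyC1; exact: PC.
- exact: PM.
elim: (m i) => [|k IHk]; first by rewrite expr0 -mpolyC1; exact: PC.
by rewrite exprS; apply: (PM) => //; exact: PX.
Qed.

End RingInduction.

Section ThreeVariables.
Variable R : fieldType.
Local Notation poly3 := (mpoly 3 R).
Local Notation X i := (mpolyX R (mnm1 i)).
Variable k : 'I_3.

(** The variable [X k] is the main one of an iterated polynomial ring, to which
    Gauss's lemma applies. *)
Definition to_iterated : poly3 -> {poly {poly {poly R}}} :=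
  mmap (polyC \o polyC \o polyC)
    (fun l => if unlift k l is Some m then
       if m == 0 then 'X%:P%:P else 'X%:P else 'X).

Definition const3 : {rmorphism R -> poly3} := @mpolyC 3 R.
Definition of_iterated1 : {rmorphism {poly R} -> poly3} :=
  (horner_eval (X (lift k 0)) \o map_poly const3).
Definition of_iterated2 : {rmorphism {poly {poly R}} -> poly3} :=
  (horner_eval (X (lift k 1)) \o map_poly of_iterated1).
Definition of_iterated : {rmorphism {poly {poly {poly R}}} -> poly3} :=
  (horner_eval (X k) \o map_poly of_iterated2).

Definition to_iterated_rmorphism :
  {rmorphism poly3 -> {poly {poly {poly R}}}} := to_iterated.

Lemma of_iterated1C x : of_iterated1 x%:P = mpolyC 3 x.
Proof.
by rewrite -[LHS]/((map_poly const3 x%:P).[_]) map_polyC hornerC.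
Qed.

Lemma of_iterated2C x : of_iterated2 x%:P = of_iterated1 x.
Proof.
by rewrite -[LHS]/((map_poly of_iterated1 x%:P).[_]) map_polyC hornerC.
Qed.

Lemma of_iteratedC x : of_iterated x%:P = of_iterated2 x.
Proof.
by rewrite -[LHS]/((map_poly of_iterated2 x%:P).[_]) map_polyC hornerC.
Qed.

Lemma of_iterated1X : of_iterated1 'X = X (lift k 0).
Proof.
by rewrite -[LHS]/((map_poly const3 'X).[_]) map_polyX hornerX.
Qed.

Lemma of_iterated2X : of_iterated2 'X = X (lift k 1).
Proof.
by rewrite -[LHS]/((map_poly of_iterated1 'X).[_]) map_polyX hornerX.
Qed.

Lemma of_iteratedX : of_iterated 'X = X k.
Proof.
by rewrite -[LHS]/((map_poly of_iterated2 'X).[_]) map_polyX hornerX.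
Qed.

Lemma of_iterated1E p x : of_iterated1 (p * 'X + x%:P) =
  of_iterated1 p * X (lift k 0) + mpolyC 3 x.
Proof. by rewrite rmorphD rmorphM of_iterated1X of_iterated1C. Qed.

Lemma of_iterated2E p x : of_iterated2 (p * 'X + x%:P) =
  of_iterated2 p * X (lift k 1) + of_iterated1 x.
Proof. by rewrite rmorphD rmorphM of_iterated2X of_iterated2C. Qed.

Lemma of_iteratedE p x : of_iterated (p * 'X + x%:P) =
  of_iterated p * X k + of_iterated2 x.
Proof. by rewrite rmorphD rmorphM of_iteratedX of_iteratedC. Qed.

Lemma to_iteratedX l : to_iterated (X l) = if unlift k l is Some m then
       if m == 0 then 'X%:P%:P else 'X%:P else 'X.
Proof. by rewrite /to_iterated mmapX mmap1U. Qed.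

Lemma to_iteratedC c : to_iterated (mpolyC 3 c) = c%:P%:P%:P.
Proof. by rewrite /to_iterated mmapC. Qed.

Lemma to_iterated0 : to_iterated 0 = 0.
Proof. exact: (rmorph0 to_iterated_rmorphism). Qed.

Lemma to_iteratedD p q : to_iterated (p + q) = to_iterated p + to_iterated q.
Proof. exact: (rmorphD to_iterated_rmorphism). Qed.

Lemma to_iteratedM p q : to_iterated (p * q) = to_iterated p * to_iterated q.
Proof. exact: (rmorphM to_iterated_rmorphism). Qed.

Lemma of_iteratedK : cancel of_iterated to_iterated.
Proof.
have K1 p : to_iterated (of_iterated1 p) = p%:P%:P.
  elim/poly_ind: p => [|p x IHp]; first by rewrite rmorph0 to_iterated0 ?polyC0.
  rewrite of_iterated1E !(to_iteratedD, to_iteratedM) to_iteratedC.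
  by rewrite to_iteratedX liftK eqxx IHp !(rmorphD, rmorphM).
have K2 p : to_iterated (of_iterated2 p) = p%:P.
  elim/poly_ind: p => [|p x IHp]; first by rewrite rmorph0 to_iterated0 ?polyC0.
  rewrite of_iterated2E !(to_iteratedD, to_iteratedM) to_iteratedX liftK K1.
  by rewrite IHp !(rmorphD, rmorphM).
elim/poly_ind => [|p x IHp]; first by rewrite rmorph0 to_iterated0 ?polyC0.
rewrite of_iteratedE !(to_iteratedD, to_iteratedM) to_iteratedX unlift_none.
by rewrite K2 IHp.
Qed.

Lemma to_iteratedK : cancel to_iterated of_iterated.
Proof.
apply: mpoly_ring_ind => [c|l|p q IHp IHq|p q IHp IHq].
- by rewrite to_iteratedC of_iteratedC of_iterated2C of_iterated1C.
- rewrite to_iteratedX; case: (unliftP k l) => [m ->|->]; last first.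
    exact: of_iteratedX.
  have [->|m0] := eqVneq m 0.
    by rewrite of_iteratedC of_iterated2C of_iterated1X.
  rewrite of_iteratedC.
  rewrite of_iterated2X; congr (X (lift k _)).
  by case: m m0 => [[|[|m]] m2] //= _; apply: val_inj.
- by rewrite to_iteratedD rmorphD IHp IHq.
- by rewrite to_iteratedM rmorphM IHp IHq.
Qed.

Lemma to_iterated_unit p :
  (to_iterated p \is a GRing.unit) = (p \is a GRing.unit).
Proof.
apply/idP/idP => [/(rmorph_unit of_iterated)|]; first by rewrite to_iteratedK.
exact: (rmorph_unit to_iterated_rmorphism).
Qed.

Lemma to_iterated_irreducible p :
  irreducible_elt p -> irreducible_elt (to_iterated p).
Proof.
move=> [p0 pNu pI]; split=> [||q r pE].
- by apply: contra_neq p0 => p0; rewrite -[p]to_iteratedK p0 rmorph0.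
- by rewrite to_iterated_unit.
- have := pI (of_iterated q) (of_iterated r).
  rewrite -rmorphM -pE to_iteratedK -!to_iterated_unit !of_iteratedK.
  by apply.
Qed.

Lemma mderiv_of_iteratedC (c : {poly {poly R}}) :
  mderiv k (of_iterated c%:P) = 0.
Proof.
have nX m : mderiv k (X (lift k m)) = 0.
  by rewrite mderivX mnm1E eq_sym (negbTE (neq_lift _ _)) scale0r.
rewrite of_iteratedC; elim/poly_ind: c => [|p x IHp].
  by rewrite rmorph0 mderiv0.
rewrite of_iterated2E mderivD mderivM IHp mul0r add0r nX mulr0 add0r.
elim/poly_ind: x => [|x y IHx]; first by rewrite rmorph0 mderiv0.
by rewrite of_iterated1E mderivD mderivM IHx mul0r add0r nX mulr0 add0r mderivC.
Qed.

(** Either [f] is itself free of the variable [k], or this variable can be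
    eliminated in the iterated polynomial ring. *)
Lemma mpoly_elimination (f g : poly3) : irreducible_elt f -> ~ divides f g ->
  exists u v, u * f + v * g != 0 /\ mderiv k (u * f + v * g) = 0.
Proof.
move=> irr_f ndvd; have irr_f' := to_iterated_irreducible irr_f.
have fact2 : factorial_ring {poly {poly R}}.
  by do 2!apply: factorial_ring_poly; exact: factorial_field.
have [sf|sf] := ltnP 1 (size (to_iterated f)); last first.
  exists 1, 0; rewrite mul1r mul0r addr0; split; first by have [] := irr_f.
  by rewrite -[f]to_iteratedK (size1_polyC sf) mderiv_of_iteratedC.
have ndvd' : ~ divides (to_iterated f) (to_iterated g).
  move=> [h gE]; apply: ndvd; exists (of_iterated h).
  by rewrite -[LHS]to_iteratedK gE rmorphM to_iteratedK.
have [u [v [c [c0 uvE]]]] := irreducible_elimination fact2 irr_f' sf ndvd'.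
exists (of_iterated u), (of_iterated v).
have -> : of_iterated u * f + of_iterated v * g = of_iterated c%:P.
  by rewrite -uvE rmorphD !rmorphM !to_iteratedK.
split; last exact: mderiv_of_iteratedC.
apply: contra_neq c0 => /(congr1 to_iterated).
by rewrite of_iteratedK to_iterated0 => /eqP; rewrite polyC_eq0 => /eqP.
Qed.

End ThreeVariables.

(** * Vectors of dimension three *)

Section Vectors3.

Lemma ord3_ind (P : 'I_3 -> Prop) : P 0 -> P 1 -> P 2 -> forall i, P i.
Proof.
move=> P0 P1 P2 [[|[|[|//]]] i3].
- by have -> : Ordinal i3 = 0 by exact: val_inj.
- by have -> : Ordinal i3 = 1 by exact: val_inj.
- by have -> : Ordinal i3 = 2 by exact: val_inj.
Qed.

Lemma sum3E (V : nmodType) (f : 'I_3 -> V) : \sum_i f i = f 0 + f 1 + f 2.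
Proof.
rewrite !big_ord_recr big_ord0 /= add0r.
by congr (f _ + f _ + f _); exact: val_inj.
Qed.

Variable K : comNzRingType.
Implicit Types u v w g : 'cV[K]_3.

Lemma cV3P u v : u 0 0 = v 0 0 -> u 1 0 = v 1 0 -> u 2 0 = v 2 0 -> u = v.
Proof.
by move=> *; apply/matrixP => i j; rewrite (ord1 j); move: i; exact: ord3_ind.
Qed.

Lemma dotE u v : dot u v = u 0 0 * v 0 0 + u 1 0 * v 1 0 + u 2 0 * v 2 0.
Proof. exact: sum3E. Qed.

Lemma crossE u v :
  (cross u v 0 0 = u 1 0 * v 2 0 - u 2 0 * v 1 0) *
  (cross u v 1 0 = u 2 0 * v 0 0 - u 0 0 * v 2 0) *
  (cross u v 2 0 = u 0 0 * v 1 0 - u 1 0 * v 0 0).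
Proof. by rewrite /cross /vec3 !mxE. Qed.

Lemma mulmx3E (M : 'M[K]_3) u i :
  (M *m u) i 0 = M i 0 * u 0 0 + M i 1 * u 1 0 + M i 2 * u 2 0.
Proof. by rewrite mxE sum3E. Qed.

Lemma cross_crossr g u v :
  cross g (cross u v) = dot g v *: u - dot g u *: v.
Proof. by apply: cV3P; rewrite !crossE !mxE !dotE; ring. Qed.

End Vectors3.

Section VectorAlgebra.
Variable K : realFieldType.
Local Notation vec := 'cV[K]_3.
Implicit Types u v w n m : vec.

Lemma dotC u v : dot u v = dot v u.
Proof. by rewrite !dotE; ring. Qed.

Lemma dotDr u v w : dot u (v + w) = dot u v + dot u w.
Proof. by rewrite !dotE !mxE; ring. Qed.

Lemma dotZr k u v : dot u (k *: v) = k * dot u v.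
Proof. by rewrite !dotE !mxE; ring. Qed.

Lemma dotDl u v w : dot (u + v) w = dot u w + dot v w.
Proof. by rewrite !dotE !mxE; ring. Qed.

Lemma dotZl k u v : dot (k *: u) v = k * dot u v.
Proof. by rewrite !dotE !mxE; ring. Qed.

Lemma dot0r u : dot u 0 = 0.
Proof. by rewrite dotE !mxE !mulr0 !addr0. Qed.

Lemma dot0l u : dot 0 u = 0.
Proof. by rewrite dotC dot0r. Qed.

Lemma dotNl u v : dot (- u) v = - dot u v.
Proof. by rewrite !dotE !mxE; ring. Qed.

Lemma dot_trmx (M : 'M[K]_3) u v : dot (M^T *m u) v = dot u (M *m v).
Proof. by rewrite !dotE !mulmx3E !mxE; ring. Qed.

Lemma dot_cross_self u v : (dot u (cross u v) = 0) * (dot v (cross u v) = 0).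
Proof. by split; rewrite dotE !crossE; ring. Qed.

Lemma lagrange_identity u v :
  dot u u * dot v v - dot u v ^+ 2 = dot (cross u v) (cross u v).
Proof. by rewrite !dotE !crossE; ring. Qed.

Lemma dot_self_gt0 u : u != 0 -> 0 < dot u u.
Proof.
move=> u0; rewrite lt0r dotE -!expr2 !addr_ge0 ?sqr_ge0// andbT.
apply: contraNneq u0 => /eqP.
by rewrite !paddr_eq0 ?addr_ge0 ?sqr_ge0// !sqrf_eq0 =>
  /andP[/andP[/eqP ? /eqP ?] /eqP ?]; apply/eqP/cV3P; rewrite mxE.
Qed.

Lemma cross_eq0_collinear n m : cross n m = 0 ->
  dot n n *: m = dot n m *: n.
Proof.
move=> nm; have /eqP : dot n m *: n - dot n n *: m = 0.
  rewrite -cross_crossr nm.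
  by apply: cV3P; rewrite crossE !mxE !mulr0 subrr.
by rewrite subr_eq0 => /eqP.
Qed.

Lemma normal_collinear n u v : n != 0 -> dot n u = 0 -> dot n v = 0 ->
  cross u v = (dot n (cross u v) / dot n n) *: n.
Proof.
move=> n0 nu nv; have nn := lt0r_neq0 (dot_self_gt0 n0).
have /cross_eq0_collinear E : cross n (cross u v) = 0.
  by rewrite cross_crossr nu nv !scale0r subr0.
by rewrite mulrC -scalerA -E scalerA mulVf// scale1r.
Qed.

Lemma tangent_decomposition u v w n : n != 0 -> cross u v != 0 ->
  dot n u = 0 -> dot n v = 0 -> dot n w = 0 ->
  exists a b, w = a *: u + b *: v.
Proof.
move=> n0 m0 nu nv nw; have mm := lt0r_neq0 (dot_self_gt0 m0).
have mw : dot (cross u v) w = 0.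
  by rewrite (normal_collinear n0 nu nv) dotZl nw mulr0.
have E : dot (cross u v) (cross u v) *: w =
    dot (cross w v) (cross u v) *: u + dot (cross u w) (cross u v) *: v +
    dot (cross u v) w *: cross u v.
  by apply: cV3P; rewrite !mxE !dotE !crossE /=; ring.
exists (dot (cross w v) (cross u v) / dot (cross u v) (cross u v)),
       (dot (cross u w) (cross u v) / dot (cross u v) (cross u v)).
move: E; rewrite mw scale0r addr0 => E.
rewrite -[LHS]scale1r -(mulVf mm) -scalerA E scalerDr !scalerA.
by rewrite ![_^-1 * _]mulrC.
Qed.

Lemma coplanar_of_orthogonal w u v z : w != 0 ->
  dot w u = 0 -> dot w v = 0 -> dot w z = 0 -> dot u (cross v z) = 0.
Proof.
move=> w0 wu wv wz; have ww := lt0r_neq0 (dot_self_gt0 w0).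
by rewrite (normal_collinear w0 wv wz) dotZr (dotC u w) wu mulr0.
Qed.

End VectorAlgebra.

(** * Partial derivatives of polynomials *)

Section Derivatives.
Variables (n : nat) (R : numDomainType).
Local Notation polyn := (mpoly n R).

Lemma msize_mderiv_lt (i : 'I_n) (p : polyn) k :
  (msize p <= k.+1)%N -> (msize (mderiv i p) <= k)%N.
Proof.
move=> sp; rewrite msizeE; apply/bigmax_leqP_seq => m + _.
rewrite -[m \in _]negbK -mcoeff_eq0 mcoeff_deriv mulrn_eq0/= mcoeff_eq0 negbK.
by move=> /msize_mdeg_lt; rewrite mdegD mdeg1 addn1 => /leq_trans/(_ sp).
Qed.

Lemma mderiv_eq0_const (p : polyn) :
  (forall i, mderiv i p = 0) -> p = mpolyC n (mcoeff mnm0 p).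
Proof.
move=> dp; apply/mpolyP => m; rewrite mcoeffC.
have [->|] := eqVneq m mnm0; first by rewrite mulr1.
rewrite -mdeg_eq0 mdegE sum_nat_eq0 => /forallPn[i /=]; rewrite -lep1mP => mi.
rewrite mulr0; have /(congr1 (mcoeff (mnm_sub m (mnm1 i)))) := dp i.
rewrite mcoeff_deriv mcoeff0 submK// => /eqP.
by rewrite mulrn_eq0/= => /eqP.
Qed.

(** Differentiating lowers the degree down to the constants. *)
Lemma mderiv_stable_eq0 (Z : polyn -> Prop) :
  (forall p, Z p -> forall i, Z (mderiv i p)) ->
  (forall c, Z (mpolyC n c) -> c = 0) -> forall p, Z p -> p = 0.
Proof.
move=> Zd Zc p; move: {2}(msize p) (leqnn (msize p)) => k.
elim: k p => [|k IHk] p sp Zp.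
  by apply/eqP; rewrite -msize_poly_eq0 -leqn0.
have pE : p = mpolyC n (mcoeff mnm0 p).
  apply: mderiv_eq0_const => i; apply: IHk; last exact: Zd.
  exact: msize_mderiv_lt.
by rewrite pE in Zp *; rewrite (Zc _ Zp) mpolyC0.
Qed.

End Derivatives.

(** * Polynomial functions and their derivatives *)

Section PolynomialFunctions.
Variable R : realType.
Local Notation point := 'cV[R]_3.
Local Notation poly3 := (mpoly 3 R).

Definition grad (F : poly3) (P : point) : point :=
  \col_i peval (mderiv i F) P.

Lemma peval_meval F (P : point) : peval F P = meval (fun i => P i 0) F.
Proof. by []. Qed.

Lemma pevalD F G (P : point) : peval (F + G) P = peval F P + peval G P.
Proof. exact: mevalD. Qed.
Lemma pevalM F G (P : point) : peval (F * G) P = peval F P * peval G P.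
Proof. exact: mevalM. Qed.
Lemma pevalN F (P : point) : peval (- F) P = - peval F P.
Proof. exact: mevalN. Qed.
Lemma pevalC c (P : point) : peval (mpolyC 3 c) P = c.
Proof. exact: mevalC. Qed.
Lemma peval0 (P : point) : peval 0 P = 0.
Proof. exact: meval0. Qed.
Lemma pevalX i (P : point) : peval (mpolyX R (mnm1 i)) P = P i 0.
Proof. exact: mevalXU. Qed.

Lemma is_derive_peval (W : normedModType R) (f : W -> point) p v
    (df : 'I_3 -> R) F :
  (forall i, is_derive p v (fun q => f q i 0) (df i)) ->
  is_derive p v (fun q => peval F (f q)) (\sum_i grad F (f p) i 0 * df i).
Proof.
move=> fdf; elim/mpoly_ring_ind: F => [c|l|F G IHF IHG|F G IHF IHG].
- under eq_fun do rewrite pevalC.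
  rewrite big1; first exact: is_derive_cst.
  by move=> i _; rewrite mxE mderivC peval_meval meval0 mul0r.
- under eq_fun do rewrite pevalX.
  apply: is_derive_eq.
  rewrite (bigD1 l)//= big1 ?addr0 => [|i il].
    rewrite mxE mderivX mnm1E eqxx scale1r.
    have -> : mnm_sub (mnm1 l) (mnm1 l) = mnm0.
      by apply/mnmP => j; rewrite mnmBE subnn mnm0E.
    by rewrite peval_meval mpolyX0 meval1 mul1r.
  by rewrite mxE mderivX mnm1E eq_sym (negbTE il) scale0r peval0 mul0r.
- under eq_fun do rewrite pevalD.
  apply: is_derive_eq; rewrite -big_split/=; apply: eq_bigr => i _.
  by rewrite !mxE mderivD pevalD mulrDl.
- under eq_fun do rewrite pevalM.
  apply: is_derive_eq; rewrite /GRing.scale/= !mulr_sumr -big_split/=.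
  apply: eq_bigr => i _; rewrite !mxE mderivM pevalD !pevalM; ring.
Qed.

Lemma is_derive_coord (W : normedModType R) (f : W -> point) p v i :
  derivable f p v -> is_derive p v (fun q => f q i 0) ('D_v f p i 0).
Proof.
move=> fd; rewrite derive_mx// mxE.
by have /derivableP := (derivable_mxP f p v).1 fd i 0.
Qed.

Lemma is_derive_peval_dot (W : normedModType R) (f : W -> point) p v F :
  derivable f p v ->
  is_derive p v (fun q => peval F (f q)) (dot (grad F (f p)) ('D_v f p)).
Proof.
by move=> fd; apply: is_derive_peval => i; exact: is_derive_coord.
Qed.

Lemma continuous_coord (W : normedModType R) (f : W -> point) p i :
  continuous_at p f -> continuous_at p (fun q => f q i 0).
Proof.
move=> fc; exact: (@continuous_comp _ _ _ f (fun M : point => M i 0) p fc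
  (@coord_continuous _ _ _ i 0 _)).
Qed.

Lemma continuous_peval (W : normedModType R) (f : W -> point) p F :
  continuous_at p f -> continuous_at p (fun q => peval F (f q)).
Proof.
move=> fc; elim/mpoly_ring_ind: F => [c|l|F G IHF IHG|F G IHF IHG].
- have -> : (fun q => peval (mpolyC 3 c) (f q)) = cst c.
    by apply/funext => q; rewrite pevalC.
  exact: cvg_cst.
- have -> : (fun q => peval (mpolyX R (mnm1 l)) (f q)) = (fun q => f q l 0).
    by apply/funext => q; rewrite pevalX.
  exact: continuous_coord.
- have -> : (fun q => peval (F + G) (f q)) =
      (fun q => peval F (f q)) \+ (fun q => peval G (f q)).
    by apply/funext => q; rewrite pevalD.
  exact: continuousD.
- have -> : (fun q => peval (F * G) (f q)) =
      (fun q => peval F (f q)) \* (fun q => peval G (f q)).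
    by apply/funext => q; rewrite pevalM.
  exact: continuousM.
Qed.

Lemma derive_locally_cst (W : normedModType R) (f : W -> R) p v c :
  (\forall q \near p, f q = c) -> 'D_v f p = 0.
Proof. by move=> fc; rewrite (near_eq_derive (g := cst c) _ fc) derive_cst. Qed.

End PolynomialFunctions.

(** * Polynomials vanishing on a surface *)

Section Vanishing.
Variable R : realType.
Local Notation point := 'cV[R]_3.
Local Notation poly3 := (mpoly 3 R).

Lemma peval_eq0 (F : poly3) : (forall P : point, peval F P = 0) -> F = 0.
Proof.
move: F; apply: mderiv_stable_eq0 => [F F0 i P|c c0]; last first.
  by rewrite -(pevalC c 0) c0.
have dF : is_derive P (delta_mx i 0 : point) (fun Q => peval F Q)
    (\sum_l grad F P l 0 * (delta_mx i 0 : point) l 0).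
  apply: is_derive_peval => l; rewrite -{2}(derive_id P (delta_mx i 0)).
  by apply: is_derive_coord; exact: derivable_id.
have [_] := dF; rewrite (@derive_locally_cst _ _ _ _ _ 0).
  rewrite (bigD1 i)//= big1 => [|l li]; last by rewrite !mxE (negbTE li) mulr0.
  by rewrite !mxE !eqxx mulr1 addr0.
by apply: filterE => Q; exact: F0.
Qed.

(** A covector that kills [u] and [v] is parallel to their cross product. *)
Lemma cross_annihilator (u v g : point) (k : 'I_3) : cross u v k 0 != 0 ->
  g k 0 = 0 -> dot g u = 0 -> dot g v = 0 -> g = 0.
Proof.
move=> + + gu gv; have /matrixP gm : cross g (cross u v) = 0.
  by rewrite cross_crossr gu gv !scale0r subr0.
move: (cross u v) gm => m gm; have [[gm0 gm1] gm2] := (gm 0 0, gm 1 0, gm 2 0).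
move: gm0 gm1 gm2; rewrite !crossE !mxE; elim/ord3_ind: k => gm0 gm1 gm2 m0 gk.
all: rewrite gk ?mul0r ?subr0 ?sub0r in gm0 gm1 gm2.
all: apply: cV3P; rewrite mxE//; apply: (mulIf m0); rewrite mul0r.
all: by [|apply: oppr_inj; rewrite oppr0].
Qed.

Section Patch.
Variables (U : set (R * R)) (x : R * R -> point).
Hypothesis Ux : regular_param U x.

Lemma patch_nbhs p : U p -> nbhs p U.
Proof. by move=> Up; apply: open_nbhs_nbhs; split=> //; case: Ux. Qed.

Lemma patch_continuous p : U p -> continuous_at p x.
Proof. by case: Ux => _ [xc _] _ /xc. Qed.

Lemma patch_derivable p : U p ->
  derivable x p ((1, 0) : R * R) /\ derivable x p ((0, 1) : R * R).
Proof. by case: Ux => _ [_ [xd _ _]] _ /xd. Qed.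

Lemma patch_C2 : class_C 2 U (Du x) /\ class_C 2 U (Dv x).
Proof. by case: Ux => _ [_ [_ Cu Cv]] _; exact (conj Cu Cv). Qed.

Lemma patch_cross p : U p -> cross (Du x p) (Dv x p) != 0.
Proof. by case: Ux => _ _; apply. Qed.

Lemma continuous_cross_patch p i : U p ->
  continuous_at p (fun q => cross (Du x q) (Dv x q) i 0).
Proof.
move=> Up; have [Cu Cv] := patch_C2.
have cu j : continuous_at p (fun q => Du x q j 0).
  by apply: continuous_coord; exact: Cu.1.
have cv j : continuous_at p (fun q => Dv x q j 0).
  by apply: continuous_coord; exact: Cv.1.
have cuv j k : continuous_at p
    (fun q => Du x q j 0 * Dv x q k 0 - Du x q k 0 * Dv x q j 0).
  exact: (continuousB (continuousM (cu j) (cv k)) (continuousM (cu k) (cv j))).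
elim/ord3_ind: i.
- have -> : (fun q => cross (Du x q) (Dv x q) 0 0) =
      fun q => Du x q 1 0 * Dv x q 2 0 - Du x q 2 0 * Dv x q 1 0.
    by apply/funext => q; rewrite crossE.
  exact: cuv.
- have -> : (fun q => cross (Du x q) (Dv x q) 1 0) =
      fun q => Du x q 2 0 * Dv x q 0 0 - Du x q 0 0 * Dv x q 2 0.
    by apply/funext => q; rewrite crossE.
  exact: cuv.
- have -> : (fun q => cross (Du x q) (Dv x q) 2 0) =
      fun q => Du x q 0 0 * Dv x q 1 0 - Du x q 1 0 * Dv x q 0 0.
    by apply/funext => q; rewrite crossE.
  exact: cuv.
Qed.

Lemma dot_grad_patch (F : poly3) c p : U p ->
  (\forall q \near p, peval F (x q) = c) ->
  dot (grad F (x p)) (Du x p) = 0 /\ dot (grad F (x p)) (Dv x p) = 0.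
Proof.
move=> Up Fc; have [xu xv] := patch_derivable Up; split.
- have [_ <-] := is_derive_peval_dot F xu.
  exact: derive_locally_cst Fc.
- have [_ <-] := is_derive_peval_dot F xv.
  exact: derive_locally_cst Fc.
Qed.

(** Some component [k] of the normal vector is nonzero on an open piece of the
    patch, so the two other coordinates are independent there: a polynomial in
    them that vanishes has vanishing partial derivatives. *)
Lemma patch_free_variable : U !=set0 -> exists k : 'I_3, forall F : poly3,
  mderiv k F = 0 -> (forall p, U p -> peval F (x p) = 0) -> F = 0.
Proof.
move=> [p0 Up0].
have [k ck] : exists k : 'I_3, cross (Du x p0) (Dv x p0) k 0 != 0.
  apply: contrapT => nk; have /eqP[] := patch_cross Up0.
  apply/matrixP => i j; rewrite ord1 [RHS]mxE; apply: contrapT => ci.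
  by apply: nk; exists i; exact/eqP.
pose U' := [set p | U p /\ cross (Du x p) (Dv x p) k 0 != 0].
have U'nbhs p : U' p -> nbhs p U'.
  move=> [Up cp]; apply: filterI (patch_nbhs Up) _.
  exact: cvgr_neq0 (@continuous_cross_patch p k Up) cp.
exists k => F dF F0.
suff: forall G : poly3,
    (mderiv k G = 0 /\ forall p, U' p -> peval G (x p) = 0) -> G = 0.
  by apply; split=> // p [Up _]; exact: F0.
apply: mderiv_stable_eq0 => [G [dG G0] i|c [_ /(_ p0)]]; last first.
  by rewrite pevalC; apply.
split=> [|p U'p]; first by rewrite mderiv_comm dG mderiv0.
have [Up cp] := U'p.
have [gu gv] : dot (grad G (x p)) (Du x p) = 0 /\
    dot (grad G (x p)) (Dv x p) = 0.
  apply: (@dot_grad_patch G 0) => //; apply: filterS (U'nbhs p U'p) => q.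
  exact: G0.
have := cross_annihilator cp _ gu gv; rewrite mxE dG peval0.
by move=> /(_ erefl)/matrixP/(_ i 0); rewrite !mxE.
Qed.

End Patch.

(** The real zero set of an irreducible polynomial determines the polynomial as
    soon as it contains a piece of regular surface: otherwise an elimination
    would confine a regular surface to a cylinder over a plane curve. *)
Lemma irreducible_divides (F G : poly3) (S : set point) :
  irreducible_elt F ->
  (exists U x, [/\ regular_param U x, U !=set0 & x @` U `<=` S]) ->
  S `<=` zero_set F -> S `<=` zero_set G -> divides F G.
Proof.
move=> irrF [U [x [Ux U0 xS]]] SF SG; apply: contrapT => ndvd.
have [k kP] := patch_free_variable Ux U0.
have [u [v [uv0 duv]]] := mpoly_elimination k irrF ndvd.
move/eqP: uv0; apply; apply: kP => // p Up.
have Sp : S (x p) by apply: xS; exists p.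
by rewrite pevalD !pevalM (SF _ Sp) (SG _ Sp) !mulr0 addr0.
Qed.

End Vanishing.

(** * Affine vector fields acting on polynomials *)

Section LieDerivative.
Variable R : realType.
Local Notation point := 'cV[R]_3.
Local Notation poly3 := (mpoly 3 R).
Local Notation X i := (mpolyX R (mnm1 i)).

Definition affine_form (w Q : point) : poly3 :=
  \sum_j mpolyC 3 (w j 0) * (X j - mpolyC 3 (Q j 0)).

Lemma peval_affine_form w Q P : peval (affine_form w Q) P = dot w (P - Q).
Proof.
rewrite /affine_form !sum3E dotE !(pevalD, pevalM, pevalN, pevalC, pevalX).
by rewrite !mxE.
Qed.

Lemma mderiv_affine_form w Q i : mderiv i (affine_form w Q) = mpolyC 3 (w i 0).
Proof.
rewrite /affine_form raddf_sum (bigD1 i)//= big1 ?addr0 => [|j ji].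
  rewrite mderiv_mulC mderivB mderivC subr0 mderivX mnm1E eqxx scale1r.
  have -> : mnm_sub (mnm1 i) (mnm1 i) = mnm0.
    by apply/mnmP => j; rewrite mnmBE subnn mnm0E.
  by rewrite mpolyX0 mulr1.
rewrite mderiv_mulC mderivB mderivC subr0 mderivX mnm1E (negbTE ji).
by rewrite scale0r mulr0.
Qed.

Lemma msize_affine_form w Q : (msize (affine_form w Q) <= 2)%N.
Proof.
rewrite /affine_form; apply: (big_ind (fun G => msize G <= 2)%N).
- by rewrite msize0.
- by move=> G H sG sH; rewrite (leq_trans (msizeD_le _ _))// geq_max sG sH.
move=> j _; rewrite mul_mpolyC (leq_trans (msizeZ_le _ _))//.
rewrite (leq_trans (msizeD_le _ _))// msizeX mdeg1 -mpolyCN geq_max leqnn.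
by rewrite msizeC; case: eqP.
Qed.

Variables (C : 'M[R]_3) (Q : point).

(** The derivative of [F] along the vector field [P |-> C (P - Q)]. *)
Definition lie (F : poly3) : poly3 :=
  \sum_l affine_form (row l C)^T Q * mderiv l F.

Lemma peval_lie F P : peval (lie F) P = dot (grad F P) (C *m (P - Q)).
Proof.
rewrite /lie !sum3E !pevalD !pevalM !peval_affine_form !dotE !mulmx3E !mxE.
by ring.
Qed.

Lemma lieD F G : lie (F + G) = lie F + lie G.
Proof.
by rewrite -big_split; apply: eq_bigr => l _; rewrite mderivD mulrDr.
Qed.

Lemma lieN F : lie (- F) = - lie F.
Proof. by rewrite -sumrN; apply: eq_bigr => l _; rewrite mderivN mulrN. Qed.

Lemma lieM F G : lie (F * G) = lie F * G + F * lie G.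
Proof.
rewrite mulr_suml mulr_sumr -big_split; apply: eq_bigr => l _ /=.
by rewrite mderivM; ring.
Qed.

Lemma mderiv_lie i F :
  mderiv i (lie F) = lie (mderiv i F) + \sum_l mpolyC 3 (C l i) * mderiv l F.
Proof.
rewrite raddf_sum -big_split; apply: eq_bigr => l _ /=.
by rewrite mderivM mderiv_affine_form !mxE mderiv_comm addrC.
Qed.

Lemma msize_lie F : (msize (lie F) <= msize F)%N.
Proof.
have [->|F0] := eqVneq F 0.
  by rewrite /lie big1 ?msize0// => l _; rewrite mderiv0 mulr0.
rewrite /lie; apply: (big_ind (fun G => msize G <= msize F)%N).
- by rewrite msize0.
- move=> G H sG sH; rewrite (leq_trans (msizeD_le _ _))// geq_max sG.
  exact: sH.
move=> l _; have [->|dF0] := eqVneq (mderiv l F) 0.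
  by rewrite mulr0 msize0.
have [->|a0] := eqVneq (affine_form (row l C)^T Q) 0.
  by rewrite mul0r msize0.
rewrite /=; have sF : (0 < msize F)%N by rewrite lt0n msize_poly_eq0.
have := @msize_mderiv_lt _ _ l F (msize F).-1.
rewrite (prednK sF) => /(_ (leqnn _)) sd; rewrite msizeM//.
have := msize_affine_form (row l C)^T Q.
move: sF sd; move: (mmeasure _ F) (mmeasure _ (mderiv l F)) => n m.
by move: (mmeasure _ _) => k; lia.
Qed.

(** The quotient of [lie F] by [F] is a constant, as an affine field does not
    raise degrees. *)
Lemma lie_eigenvector F (S : set point) : irreducible_elt F ->
  (exists U x, [/\ regular_param U x, U !=set0 & x @` U `<=` S]) ->
  S `<=` zero_set F ->
  (forall P, S P -> dot (grad F P) (C *m (P - Q)) = 0) ->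
  exists lambda, lie F = mpolyC 3 lambda * F.
Proof.
move=> irrF S2 SF Stan; have [F0 _ _] := irrF.
have [|G lieE] := irreducible_divides irrF S2 SF (G := lie F).
  by move=> P /Stan; rewrite -peval_lie.
have [G0|G0] := eqVneq G 0.
  by exists 0; rewrite lieE G0 mpolyC0 mulr0 mul0r.
exists (mcoeff mnm0 G); rewrite lieE mulrC; congr (_ * _).
apply: msize1_polyC; have := msize_lie F; rewrite lieE msizeM//.
have : (0 < msize F)%N by rewrite lt0n msize_poly_eq0.
by move: (mmeasure _ F) (mmeasure _ G) => n m; lia.
Qed.

End LieDerivative.

(** * The canonical affine rotation groups and their generators *)

Section CanonicalGroups.
Variable R : realType.
Local Notation point := 'cV[R]_3.
Local Notation poly3 := (mpoly 3 R).

Definition elliptic_gen : 'M[R]_3 :=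
  mat3 [:: [:: 0; -1; 0]; [:: 1; 0; 0]; [:: 0; 0; 0]].
Definition hyperbolic_gen : 'M[R]_3 :=
  mat3 [:: [:: 0; 1; 0]; [:: 1; 0; 0]; [:: 0; 0; 0]].
Definition parabolic_gen : 'M[R]_3 :=
  mat3 [:: [:: 0; 0; 0]; [:: 1; 0; 0]; [:: 0; 1; 0]].

Inductive canonical_group : (R -> 'M[R]_3) -> 'M[R]_3 -> Prop :=
| Elliptic : canonical_group (@elliptic R) elliptic_gen
| Hyperbolic : canonical_group (@hyperbolic R) hyperbolic_gen
| Parabolic : canonical_group (@parabolic R) parabolic_gen.

Local Notation e3 := (vec3 0 0 1 : point).

Variables (G : R -> 'M[R]_3) (A : 'M[R]_3).
Hypothesis GA : canonical_group G A.

Lemma canonical_group0 : G 0 = 1%:M.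
Proof.
case: GA; apply/matrixP => i j; rewrite !mxE; move: i j; apply: ord3_ind;
  apply: ord3_ind => /=; rewrite ?(cos0, sin0, oppr0) ?expR0 ?expr0n ?mul0r//;
  rewrite /cosh /sinh oppr0 expR0 ?subrr ?mul0r//; by field.
Qed.

Lemma canonical_group_axis t : G t *m e3 = e3.
Proof.
by case: GA; apply: cV3P; rewrite mulmx3E !mxE/= !mulr0 ?mulr1 !add0r.
Qed.

Lemma generator_axis : A *m e3 = 0.
Proof.
by case: GA; apply: cV3P; rewrite mulmx3E !mxE/= !mulr0 ?mulr1 !add0r.
Qed.

Lemma generator_trace : A 0 0 + A 1 1 + A 2 2 = 0.
Proof. by case: GA; rewrite !mxE/= !addr0. Qed.

Lemma generator_kernel D : A *m D = 0 -> D = D 2 0 *: e3.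
Proof.
move=> /matrixP AD; have [[]] := (AD 0 0, AD 1 0, AD 2 0).
case: GA; rewrite !mulmx3E !mxE/= => *; apply: cV3P; rewrite !mxE/=; lra.
Qed.

Lemma is_derive_cosh (t : R) : is_derive t 1 (@cosh R) (sinh t).
Proof.
rewrite /cosh /sinh; apply: is_derive_eq.
by rewrite scaler0 scaler0 add0r /GRing.scale/=; ring.
Qed.

Lemma is_derive_sinh (t : R) : is_derive t 1 (@sinh R) (cosh t).
Proof.
rewrite /cosh /sinh; apply: is_derive_eq.
by rewrite scaler0 scaler0 add0r /GRing.scale/=; ring.
Qed.

Lemma is_derive_half_square (t : R) : is_derive t 1 (fun s : R => s ^+ 2 / 2) t.
Proof.
apply: is_derive_eq.
by rewrite !scaler0 add0r /GRing.scale/= !mulr1; field.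
Qed.

Lemma is_derive_group (t : R) i j :
  is_derive t (1 : R) (fun s => G s i j) ((A *m G t) i j).
Proof.
rewrite mxE sum3E; case: GA; under eq_fun do rewrite mxE; rewrite !mxE.
all: move: i j; apply: ord3_ind; apply: ord3_ind => /=.
all: rewrite ?mulr0 ?mul0r ?mulr1 ?mul1r ?mulN1r ?addr0 ?add0r.
all: try by apply: is_derive_cst.
all: try by [exact: is_derive_cosh|exact: is_derive_sinh|exact: is_derive_cst].
- exact: is_derive_cos.
- exact: is_deriveN.
- exact: is_derive_sin.
- exact: is_derive_cos.
- exact: is_derive_id.
- exact: is_derive_half_square.
- exact: is_derive_id.
Qed.

(** Orbits of the conjugated group, in the affine frame [(Q, M)]. *)
Definition orbit_curve (M : 'M[R]_3) (Q D : point) (t : R) : point :=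
  Q + M^T *m (G t *m D).

Lemma is_derive_orbit_curve M Q D (t : R) i : is_derive t (1 : R)
  (fun s => orbit_curve M Q D s i 0) ((M^T *m (A *m (G t *m D))) i 0).
Proof.
have dG k l := is_derive_group t k l.
have dGD k : is_derive t (1 : R) (fun s => (G s *m D) k 0)
    ((A *m (G t *m D)) k 0).
  under eq_fun do rewrite mulmx3E; apply: is_derive_eq.
  by rewrite mulmxA mulmx3E /GRing.scale/=; ring.
have -> : (fun s => orbit_curve M Q D s i 0) = (fun s => Q i 0 +
    (M^T i 0 * (G s *m D) 0 0 + M^T i 1 * (G s *m D) 1 0 +
     M^T i 2 * (G s *m D) 2 0)).
  by apply/funext => s; rewrite /orbit_curve mxE mulmx3E.
by apply: is_derive_eq; rewrite [RHS]mulmx3E /GRing.scale/=; ring.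
Qed.

End CanonicalGroups.

(** * Invariance of the defining polynomial *)

Section PolynomialCurves.
Variable R : realType.
Local Notation point := 'cV[R]_3.

Lemma poly_eq0_pos (p : {poly R}) : (forall t, 0 < t -> p.[t] = 0) -> p = 0.
Proof.
move=> p0.
apply: (@roots_geq_poly_eq0 _ p [seq i.+1%:R | i <- iota 0 (size p)]).
- by apply/allP => _ /mapP[i _ ->]; apply/eqP/p0; rewrite ltr0n.
- by rewrite map_inj_uniq ?iota_uniq// => i j /eqP; rewrite eqr_nat => /eqP[].
- by rewrite size_map size_iota.
Qed.

Lemma peval_polynomial_curve (c : R -> point) (p : 'I_3 -> {poly R}) F :
  (forall i s, c s i 0 = (p i).[s]) ->
  exists q : {poly R}, forall s, peval F (c s) = q.[s].
Proof.
move=> cp; elim/mpoly_ring_ind: F =>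
  [a|i|F1 F2 [q1 E1] [q2 E2]|F1 F2 [q1 E1] [q2 E2]].
- by exists a%:P => s; rewrite pevalC hornerC.
- by exists (p i) => s; rewrite pevalX cp.
- by exists (q1 + q2) => s; rewrite pevalD hornerD E1 E2.
- by exists (q1 * q2) => s; rewrite pevalM hornerM E1 E2.
Qed.

End PolynomialCurves.

Section EigenvalueZero.
Variable R : realType.
Local Notation point := 'cV[R]_3.
Local Notation poly3 := (mpoly 3 R).

Variables (G : R -> 'M[R]_3) (A M : 'M[R]_3) (Q : point).
Hypothesis GA : canonical_group G A.
Hypothesis M_orth : M^T *m M = 1%:M.
Variables (F : poly3) (lambda : R).
Hypothesis F_eigen : lie (M^T *m A *m M) Q F = mpolyC 3 lambda * F.
Hypothesis F_neq0 : F != 0.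

Let MMt : M *m M^T = 1%:M. Proof. exact: mulmx1C. Qed.

Lemma is_derive_eigen_orbit D (t : R) : is_derive t (1 : R)
  (fun s => peval F (orbit_curve G M Q D s))
  (lambda * peval F (orbit_curve G M Q D t)).
Proof.
have := is_derive_peval F (is_derive_orbit_curve GA M Q D t).
rewrite -[\sum_i _]/(dot _ _).
have -> : M^T *m (A *m (G t *m D)) =
    (M^T *m A *m M) *m (orbit_curve G M Q D t - Q).
  by rewrite /orbit_curve addrC addKr !mulmxA -(mulmxA _ M) MMt mulmx1.
by rewrite -peval_lie F_eigen pevalM pevalC.
Qed.

Lemma orbit_curve_start P : orbit_curve G M Q (M *m (P - Q)) 0 = P.
Proof.
rewrite /orbit_curve (canonical_group0 GA) mul1mx mulmxA M_orth mul1mx.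
by rewrite addrC subrK.
Qed.

Lemma peval_neq0 : exists P, peval F P != 0.
Proof.
apply: contrapT => nP; move/eqP: F_neq0; apply; apply: peval_eq0 => P.
by apply: contrapT => FP; apply: nP; exists P; exact/eqP.
Qed.

(** The orbits are periodic, and [F] gets multiplied by [exp (2 pi lambda)] over
    a period. *)
Lemma eigenvalue0_elliptic : G = @elliptic R -> lambda = 0.
Proof.
move=> Ge; have [P FP] := peval_neq0; pose D := M *m (P - Q).
pose k t := expR (- lambda * t) * peval F (orbit_curve G M Q D t).
have dk (t : R) : is_derive t (1 : R) k 0.
  have dF := is_derive_eigen_orbit D t.
  apply: is_derive_eq; rewrite /GRing.scale/=; ring.
have := is_derive_0_is_cst (2 * pi) 0 dk.
rewrite /k mulr0 expR0 mul1r.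
have -> : orbit_curve G M Q D (2 * pi) = orbit_curve G M Q D 0.
  congr (Q + M^T *m (_ *m D)); rewrite Ge; apply/matrixP => i j; rewrite !mxE.
  by rewrite mulr_natl cos2pi sin2pi cos0 sin0.
rewrite orbit_curve_start => /eqP.
rewrite -subr_eq0 -{2}[peval F P]mul1r -mulrBl mulf_eq0 (negbTE FP) orbF.
rewrite subr_eq0 -expR0 => /eqP/expR_inj/eqP.
rewrite mulf_eq0 oppr_eq0 => /orP[/eqP//|].
by rewrite gt_eqF// mulr_gt0// pi_gt0.
Qed.

(** Along an orbit [F] is a polynomial [q] in [t], while [q' = lambda q] with
    [lambda] nonzero is impossible for degree reasons. *)
Lemma eigenvalue0_parabolic : G = @parabolic R -> lambda = 0.
Proof.
move=> Gp; have [P FP] := peval_neq0.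
have [D DP] : exists D, orbit_curve G M Q D 0 = P.
  by exists (M *m (P - Q)); exact: orbit_curve_start.
pose g k : {poly R} := nth 0 [:: (D 0 0)%:P; (D 0 0)%:P * 'X + (D 1 0)%:P;
  (D 0 0 / 2)%:P * 'X^2 + (D 1 0)%:P * 'X + (D 2 0)%:P] k.
have [|q qE] := @peval_polynomial_curve R (orbit_curve G M Q D) (fun i =>
    (Q i 0)%:P + (M^T i 0)%:P * g 0%N + (M^T i 1)%:P * g 1%N +
    (M^T i 2)%:P * g 2%N) F.
  move=> i s; rewrite /orbit_curve mxE mulmx3E !mulmx3E Gp !mxE /g/=.
  by rewrite !(hornerD, hornerM, hornerC, hornerX, hornerXn); ring.
have q'E : q^`() = lambda *: q.
  apply/eqP; rewrite -subr_eq0; apply/eqP/poly_eq0_pos => t _.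
  have [_ dq] := is_derive_poly q t.
  have [_] := is_derive_eigen_orbit D t.
  rewrite (_ : (fun s => _) = horner q); last exact/funext.
  by rewrite dq qE hornerD hornerN hornerZ => ->; rewrite subrr.
apply/eqP; apply: contraT => l0.
have q0 : q != 0.
  by apply: contraNneq FP => q0; rewrite -DP qE q0 horner0.
by have := lt_size_deriv q0; rewrite q'E size_scale// ltnn.
Qed.

(** In the coordinates of the canonical frame, [F] is a polynomial [q] in [s]
    along the orbits of the plane [y = e x], where [s = exp (e t)], and
    [e s q' = lambda q]. So [F] vanishes on this plane when the sign [e] is
    opposite to that of [lambda]. *)
Lemma eigenvalue_hyperbolic : G = @hyperbolic R -> lambda != 0 ->
  exists2 w : point, w != 0 & forall P, dot w (P - Q) = 0 -> peval F P = 0.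
Proof.
move=> Gh l0; pose e : R := if 0 < lambda then -1 else 1.
have ee : e * e = 1 by rewrite /e; case: ifP => _; rewrite ?mulrNN mulr1.
have el : e * lambda < 0.
  rewrite /e; case: ifPn => [lp|]; first by rewrite mulN1r oppr_lt0.
  by rewrite -leNgt le_eqVlt (negbTE l0)/= mul1r.
exists (M^T *m vec3 (- e) 1 0).
  apply/eqP => /(congr1 (mulmx M)); rewrite mulmxA MMt mul1mx mulmx0.
  by move=> /matrixP/(_ 1 0)/eqP; rewrite !mxE/= oner_eq0.
move=> P wP; pose D := M *m (P - Q).
have PE : P = Q + M^T *m D by rewrite /D mulmxA M_orth mul1mx addrC subrK.
have D1 : D 1 0 = e * D 0 0.
  move: wP; rewrite PE addrC addKr; move: (D) => D'.
  have -> : dot (M^T *m vec3 (- e) 1 0) (M^T *m D') =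
      dot (vec3 (- e) 1 0) (M *m (M^T *m D')).
    by rewrite !dotE !mulmx3E !mxE; ring.
  rewrite mulmxA MMt mul1mx dotE !mxE/= => E; apply/eqP; rewrite -subr_eq0 -E.
  by apply/eqP; ring.
(* On the plane the group multiplies the first two coordinates by
   [s = exp (e t)]. *)
pose g k : {poly R} :=
  nth 0 [:: (D 0 0)%:P * 'X; (e * D 0 0)%:P * 'X; (D 2 0)%:P] k.
pose c s : point := Q + M^T *m vec3 (D 0 0 * s) (e * D 0 0 * s) (D 2 0).
have [|q qE] := @peval_polynomial_curve R c (fun i =>
    (Q i 0)%:P + (M^T i 0)%:P * g 0%N + (M^T i 1)%:P * g 1%N +
    (M^T i 2)%:P * g 2%N) F.
  move=> i s; rewrite /c mxE mulmx3E /g/= !(hornerD, hornerM, hornerC, hornerX).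
  by rewrite !mxE/= !addrA.
have orbE t : orbit_curve G M Q D t = c (expR (e * t)).
  rewrite /orbit_curve /c; congr (Q + M^T *m _); rewrite Gh.
  apply: cV3P; rewrite mulmx3E D1 !mxE/=; last by ring.
    by rewrite /cosh /sinh /e; case: ifP => _; rewrite ?mulN1r ?mul1r; field.
  by rewrite /cosh /sinh /e; case: ifP => _; rewrite ?mulN1r ?mul1r; field.
have q'E : e *: ('X * q^`()) = lambda *: q.
  apply/eqP; rewrite -subr_eq0; apply/eqP/poly_eq0_pos => s s0.
  have sE : expR (e * (e * ln s)) = s by rewrite mulrA ee mul1r lnK.
  have dexp : is_derive (e * ln s) (1 : R) (fun t => expR (e * t)) (e * s).
    by apply: is_derive_eq; rewrite /GRing.scale/= sE; ring.
  have [_ dq] := is_derive1_comp (is_derive_poly q _) dexp.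
  have [_] := is_derive_eigen_orbit D (e * ln s).
  rewrite (_ : (fun t => _) = horner q \o (fun t => expR (e * t))); last first.
    by apply/funext => t; rewrite orbE qE.
  rewrite dq orbE qE sE => E; rewrite hornerD hornerN !hornerZ hornerM hornerX.
  by apply/eqP; rewrite subr_eq0 -E /GRing.scale/=; apply/eqP; ring.
have q0 : q = 0.
  apply/polyP => k; rewrite coef0.
  have := congr1 (fun p : {poly R} => p`_k) q'E.
  have -> : (e *: ('X * q^`()))`_k = e * k%:R * q`_k.
    rewrite coefZ coefXM; case: k => [|k] /=; first by rewrite !mulr0 mul0r.
    by rewrite coef_deriv -mulrA mulr_natl.
  rewrite coefZ => /eqP; rewrite -subr_eq0 -mulrBl mulf_eq0 => /orP[|/eqP//].
  rewrite subr_eq0 => /eqP kl; have : 0 <= e * lambda.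
    by rewrite -kl mulrA ee mul1r ler0n.
  by rewrite leNgt el.
rewrite PE (_ : Q + _ = c 1) ?qE ?q0 ?horner0// /c !mulr1 -D1.
by congr (Q + M^T *m _); apply: cV3P; rewrite !mxE.
Qed.

End EigenvalueZero.

Section Plane.
Variable R : realType.
Local Notation point := 'cV[R]_3.
Local Notation poly3 := (mpoly 3 R).

(** The coordinates of [P] and of its orthogonal projection onto the plane are
    congruent modulo the equation of the plane, hence so are the values
    of [F]. *)
Lemma plane_division (w Q : point) (F : poly3) : w != 0 ->
  exists G : poly3, forall P, peval F P =
    dot w (P - Q) * peval G P + peval F (P - (dot w (P - Q) / dot w w) *: w).
Proof.
move=> w0; elim/mpoly_ring_ind: F =>
  [a|i|F1 F2 [G1 E1] [G2 E2]|F1 F2 [G1 E1] [G2 E2]].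
- by exists 0 => P; rewrite peval0 !pevalC mulr0 add0r.
- exists (mpolyC 3 (w i 0 / dot w w)) => P; rewrite pevalC !pevalX !mxE; ring.
- by exists (G1 + G2) => P; rewrite !pevalD {1}E1 {1}E2; ring.
exists (F1 * G2 + G1 * (F2 - affine_form w Q * G2)) => P.
rewrite !(pevalD, pevalM, pevalN) peval_affine_form.
move: (E1 P) (E2 P); move: (peval F1 _) (peval F2 _) => a b.
by move=> -> ->; ring.
Qed.

(** Such a polynomial is a multiple of the equation of the plane. *)
Lemma irreducible_vanishing_on_plane (w Q : point) (F : poly3) :
  w != 0 -> irreducible_elt F ->
  (forall P, dot w (P - Q) = 0 -> peval F P = 0) ->
  forall i j, mderiv i (mderiv j F) = 0.
Proof.
move=> w0 [_ _ FI] Fw; have [G GE] := plane_division Q F w0.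
have ww : dot w w != 0 by rewrite gt_eqF// dot_self_gt0.
have FE : F = affine_form w Q * G.
  apply/eqP; rewrite -subr_eq0; apply/eqP/peval_eq0 => P.
  rewrite pevalD pevalN pevalM peval_affine_form {1}GE Fw ?addr0 ?subrr//.
  set u := dot w (P - Q).
  have -> : dot w (P - (u / dot w w) *: w - Q) = u - u / dot w w * dot w w.
    by rewrite /u !dotE !mxE; ring.
  by rewrite divfK// subrr.
have [|] := FI _ _ FE; last first.
  move=> /andP[/eqP GC _] i j.
  rewrite FE GC !mderivM mderivC mulr0 addr0 mderiv_affine_form.
  by rewrite !mderivM !mderivC mul0r mulr0 addr0.
move=> /mulVr /(congr1 (fun H => peval H Q)).
rewrite pevalM peval_affine_form subrr dotE !mxE !mulr0 !addr0.
by rewrite mulr0 peval_meval meval1 => /esym/eqP; rewrite oner_eq0.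
Qed.

End Plane.

(** * The curvature polynomial *)

Section CurvatureForm.
Variable K : comNzRingType.

(** The quadratic form of the adjugate of the symmetric matrix [h] at [n]. *)
Definition adjugate_form (n0 n1 n2 h00 h01 h02 h11 h12 h22 : K) : K :=
  n0 * n0 * (h11 * h22 - h12 * h12) + n1 * n1 * (h00 * h22 - h02 * h02)
  + n2 * n2 * (h00 * h11 - h01 * h01)
  + n0 * n1 * (h02 * h12 - h01 * h22) + n0 * n1 * (h02 * h12 - h01 * h22)
  + n0 * n2 * (h01 * h12 - h02 * h11) + n0 * n2 * (h01 * h12 - h02 * h11)
  + n1 * n2 * (h01 * h02 - h00 * h12) + n1 * n2 * (h01 * h02 - h00 * h12).

(** A derivation acting on [n] and [h] through a traceless matrix [C] kills the
    form, since [det (1 - e C)] is [1] to first order. *)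
Lemma adjugate_form_derivation (d : K -> K)
    (n0 n1 n2 h00 h01 h02 h11 h12 h22
     c00 c01 c02 c10 c11 c12 c20 c21 c22 : K) :
  (forall a b, d (a + b) = d a + d b) -> (forall a, d (- a) = - d a) ->
  (forall a b, d (a * b) = d a * b + a * d b) ->
  c00 + c11 + c22 = 0 ->
  d n0 = - (c00 * n0 + c10 * n1 + c20 * n2) ->
  d n1 = - (c01 * n0 + c11 * n1 + c21 * n2) ->
  d n2 = - (c02 * n0 + c12 * n1 + c22 * n2) ->
  d h00 = - (c00 * h00 + c10 * h01 + c20 * h02)
          - (c00 * h00 + c10 * h01 + c20 * h02) ->
  d h01 = - (c00 * h01 + c10 * h11 + c20 * h12)
          - (c01 * h00 + c11 * h01 + c21 * h02) ->
  d h02 = - (c00 * h02 + c10 * h12 + c20 * h22)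
          - (c02 * h00 + c12 * h01 + c22 * h02) ->
  d h11 = - (c01 * h01 + c11 * h11 + c21 * h12)
          - (c01 * h01 + c11 * h11 + c21 * h12) ->
  d h12 = - (c01 * h02 + c11 * h12 + c21 * h22)
          - (c02 * h01 + c12 * h11 + c22 * h12) ->
  d h22 = - (c02 * h02 + c12 * h12 + c22 * h22)
          - (c02 * h02 + c12 * h12 + c22 * h22) ->
  d (adjugate_form n0 n1 n2 h00 h01 h02 h11 h12 h22) = 0.
Proof.
move=> dD dN dM /eqP; rewrite -addrA addrC addr_eq0 => /eqP c00E.
move=> d0 d1 d2 d00 d01 d02 d11 d12 d22.
rewrite /adjugate_form !(dD, dN, dM) d0 d1 d2 d00 d01 d02 d11 d12 d22.
have -> : c00 = - (c11 + c22) by rewrite c00E opprK.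
ring.
Qed.

End CurvatureForm.

Section CurvaturePolynomial.
Variable R : realType.
Local Notation point := 'cV[R]_3.
Local Notation poly3 := (mpoly 3 R).

Definition hess (F : poly3) (P : point) : 'M[R]_3 :=
  \matrix_(i, j) peval (mderiv i (mderiv j F)) P.

Lemma hess_sym F P : (hess F P)^T = hess F P.
Proof. by apply/matrixP => i j; rewrite !mxE mderiv_comm. Qed.

Definition curvature_poly (F : poly3) : poly3 :=
  adjugate_form (mderiv 0 F) (mderiv 1 F) (mderiv 2 F)
    (mderiv 0 (mderiv 0 F)) (mderiv 0 (mderiv 1 F)) (mderiv 0 (mderiv 2 F))
    (mderiv 1 (mderiv 1 F)) (mderiv 1 (mderiv 2 F)) (mderiv 2 (mderiv 2 F)).

Definition adjugate_form_mx (n : point) (H : 'M[R]_3) : R :=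
  adjugate_form (n 0 0) (n 1 0) (n 2 0)
    (H 0 0) (H 0 1) (H 0 2) (H 1 1) (H 1 2) (H 2 2).

Lemma peval_curvature_poly F P :
  peval (curvature_poly F) P = adjugate_form_mx (grad F P) (hess F P).
Proof.
rewrite /curvature_poly /adjugate_form_mx /adjugate_form.
by rewrite !(pevalD, pevalM, pevalN) !mxE.
Qed.

Variables (C : 'M[R]_3) (Q : point) (F : poly3).
Hypothesis C_trace : C 0 0 + C 1 1 + C 2 2 = 0.
Hypothesis F_inv : lie C Q F = 0.

(** Differentiating [lie F = 0] in the coordinate directions. *)
Lemma lie_mderiv i :
  lie C Q (mderiv i F) = - \sum_l mpolyC 3 (C l i) * mderiv l F.
Proof.
apply/eqP; rewrite -subr_eq0 opprK; have := mderiv_lie C Q i F.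
by rewrite F_inv mderiv0 => <-.
Qed.

Lemma lie_mderiv2 i j : lie C Q (mderiv i (mderiv j F)) =
  - (\sum_l mpolyC 3 (C l i) * mderiv l (mderiv j F))
  - \sum_l mpolyC 3 (C l j) * mderiv i (mderiv l F).
Proof.
have := mderiv_lie C Q i (mderiv j F); rewrite lie_mderiv mderivN.
have -> : mderiv i (\sum_l mpolyC 3 (C l j) * mderiv l F) =
    \sum_l mpolyC 3 (C l j) * mderiv i (mderiv l F).
  by rewrite raddf_sum; apply: eq_bigr => l _; exact: mderiv_mulC.
by move=> /eqP; rewrite -subr_eq => /eqP <-; rewrite addrC.
Qed.

Lemma lie_curvature_poly : lie C Q (curvature_poly F) = 0.
Proof.
apply: (@adjugate_form_derivation _ (lie C Q) _ _ _ _ _ _ _ _ _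
  (mpolyC 3 (C 0 0)) (mpolyC 3 (C 0 1)) (mpolyC 3 (C 0 2))
  (mpolyC 3 (C 1 0)) (mpolyC 3 (C 1 1)) (mpolyC 3 (C 1 2))
  (mpolyC 3 (C 2 0)) (mpolyC 3 (C 2 1)) (mpolyC 3 (C 2 2))).
- exact: lieD.
- exact: lieN.
- exact: lieM.
- by rewrite -!mpolyCD C_trace mpolyC0.
1-3: by rewrite lie_mderiv sum3E.
all: rewrite lie_mderiv2 !sum3E ?(mderiv_comm 1 0 F) ?(mderiv_comm 2 0 F).
all: by rewrite ?(mderiv_comm 2 1 F).
Qed.

End CurvaturePolynomial.

(** * Curvature and affine conormal of level surfaces *)


Section AdjugateForm.
Variable R : realType.
Local Notation point := 'cV[R]_3.

Lemma adjugate_formZ k (n : point) H :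
  adjugate_form_mx (k *: n) H = k ^+ 2 * adjugate_form_mx n H.
Proof. by rewrite /adjugate_form_mx /adjugate_form !mxE; ring. Qed.

(** Cauchy-Binet: both sides are the Gram determinant of [u] and [v] for the
    form [H], and [adj H] is the second exterior power of [H]. *)
Lemma adjugate_form_cross (u v : point) (H : 'M[R]_3) : H^T = H ->
  adjugate_form_mx (cross u v) H =
  dot (H *m u) u * dot (H *m v) v - dot (H *m v) u ^+ 2.
Proof.
move=> /matrixP HT; have := (HT 0 1, HT 0 2, HT 1 2).
rewrite !mxE => -[[h1 h2] h3].
rewrite /adjugate_form_mx /adjugate_form !crossE !dotE !mulmx3E h1 h2 h3.
ring.
Qed.

Lemma dot_symmetric (u v : point) (H : 'M[R]_3) : H^T = H ->
  dot (H *m u) v = dot (H *m v) u.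
Proof. by move=> HT; rewrite dotC -dot_trmx HT. Qed.

(** By Cauchy-Binet the form is the determinant of [H] on the plane of [u] and
    [v], which vanishes as soon as [H] has a degenerate direction there. *)
Lemma adjugate_form_degenerate (u v : point) (H : 'M[R]_3) a b : H^T = H ->
  adjugate_form_mx (cross u v) H != 0 ->
  H *m (a *: u + b *: v) = 0 -> a = 0 /\ b = 0.
Proof.
move=> HT; rewrite adjugate_form_cross// => H0 Hab.
have := congr1 (fun z => dot z u) Hab; have := congr1 (fun z => dot z v) Hab.
rewrite mulmxDr -!scalemxAr !dotDl !dotZl !dot0l (dot_symmetric u v HT).
move: (dot _ u) (dot _ v) (dot (H *m v) u) H0 => p q r H0 E1 E2.
split; apply: (mulIf H0); rewrite mul0r.
  have -> : a * (p * q - r ^+ 2) = q * (a * p + b * r) - r * (a * r + b * q).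
    by ring.
  by rewrite E1 E2 !mulr0 subrr.
have -> : b * (p * q - r ^+ 2) = p * (a * r + b * q) - r * (a * p + b * r).
  by ring.
by rewrite E1 E2 !mulr0 subrr.
Qed.

End AdjugateForm.

Section LevelSurface.
Variable R : realType.
Local Notation point := 'cV[R]_3.
Local Notation poly3 := (mpoly 3 R).

Lemma enormE (u : point) : enorm u ^+ 2 = dot u u.
Proof. by rewrite sqr_sqrtr// dotE -!expr2 !addr_ge0// sqr_ge0. Qed.

Lemma curvature_of_second_form (n u v uu uv vv : point) (H : 'M[R]_3) :
  n != 0 -> cross u v != 0 -> dot n u = 0 -> dot n v = 0 -> H^T = H ->
  dot n uu = - dot (H *m u) u -> dot n uv = - dot (H *m v) u ->
  dot n vv = - dot (H *m v) v ->
  let N := (enorm (cross u v))^-1 *: cross u v in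
  (dot N uu * dot N vv - dot N uv ^+ 2) /
    (dot u u * dot v v - dot u v ^+ 2) =
  adjugate_form_mx n H / dot n n ^+ 2.
Proof.
move=> n0 m0 nu nv HT E1 E2 E3 N.
have nn := lt0r_neq0 (dot_self_gt0 n0); have mm := lt0r_neq0 (dot_self_gt0 m0).
have BE := adjugate_form_cross u v HT.
rewrite lagrange_identity /N !dotZl; have mE := normal_collinear n0 nu nv.
set k := dot n _ / _ in mE; rewrite mE adjugate_formZ in BE.
have e2 := enormE (cross u v); move: mm; rewrite -e2.
have : enorm (cross u v) ^+ 2 = k ^+ 2 * dot n n.
  by rewrite e2 {1 2}mE dotZl dotZr mulrA -expr2.
move: (enorm _) => e eE; rewrite {1 2 3}mE !dotZl E1 E2 E3.
rewrite -[e ^+ 2 in X in _ / X]/(e ^+ 2) eE mulf_eq0 negb_or => /andP[k2 _].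
move: BE; move: (dot (H *m u) u) (dot (H *m v) v) (dot (H *m v) u) => a b d BE.
have -> : e^-1 * (k * - a) * (e^-1 * (k * - b)) - (e^-1 * (k * - d)) ^+ 2 =
    e^-1 ^+ 2 * (k ^+ 2 * (a * b - d ^+ 2)) by ring.
by rewrite -BE exprVn eE; field; rewrite nn; move: k2; rewrite sqrf_eq0.
Qed.

Lemma unit_vector_collinear (n m : point) : n != 0 -> m != 0 ->
  m = (dot n m / dot n n) *: n ->
  (enorm m)^-1 *: m = (Num.sg (dot n m) / enorm n) *: n.
Proof.
move=> n0 m0 mE; have nn := dot_self_gt0 n0.
have d0 : dot n m != 0.
  by apply: contra_neq m0 => d0; rewrite mE d0 mul0r scale0r.
have emE : enorm m = `|dot n m| / enorm n.
  rewrite /enorm {1 2}mE dotZl dotZr mulrA -expr2 sqrtrM ?sqr_ge0// sqrtr_sqr.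
  rewrite normrM normfV (gtr0_norm nn) -mulrA; congr (_ * _).
  rewrite -[X in X^-1](sqr_sqrtr (ltW nn)) expr2 invfM -mulrA mulVf ?mulr1//.
  by rewrite gt_eqF// sqrtr_gt0.
rewrite emE {2}mE scalerA; congr (_ *: _).
have e0 : enorm n != 0 by rewrite gt_eqF// sqrtr_gt0.
rewrite -enormE [X in X / _ ^+ 2]numEsg.
have {d0 emE mE} : `|dot n m| != 0 by rewrite normr_eq0.
move: (enorm n) e0 `|_| (Num.sg _) => e e0 a sg a0.
by field; rewrite e0.
Qed.

Lemma powR_quarter (b d : R) : 0 < d ->
  `|b / d ^+ 2| `^ (- 4^-1) = `|b| `^ (- 4^-1) * Num.sqrt d.
Proof.
move=> d0; rewrite normrM normfV (ger0_norm (sqr_ge0 d)).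
rewrite powRM ?normr_ge0 ?invr_ge0 ?sqr_ge0//.
congr (_ * _); rewrite -powR12_sqrt ?ltW// -powR_invn ?ltW// -powRrM.
by congr (_ `^ _); field.
Qed.

Lemma near_sgr (W : normedModType R) (f : W -> R) (p : W) :
  continuous_at p f -> f p != 0 ->
  \forall q \near p, Num.sg (f q) = Num.sg (f p).
Proof.
move=> fc; case: (ltgtP (f p) 0) => // fp _.
- have : \forall q \near p, f q < 0 by exact: cvgr_lt fp.
  by apply: filterS => q fq; rewrite !ltr0_sg.
- have : \forall q \near p, 0 < f q by exact: cvgr_gt fp.
  by apply: filterS => q fq; rewrite !gtr0_sg.
Qed.

Lemma is_derive_comp1 (W : normedModType R) (g : W -> R) (phi : R -> R)
    p v dg dphi :
  is_derive p v g dg -> is_derive (g p) (1 : R) phi dphi ->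
  is_derive p v (phi \o g) (dphi * dg).
Proof.
have lineE (f : W -> R) df : is_derive p v f df <->
    is_derive (0 : R) (1 : R) (fun h : R => f (h *: v + p)) df.
  have dE : 'D_v f p = 'D_1 (fun h : R => f (h *: v + p)) 0.
    rewrite /derive; set g1 := fun h => h^-1 *: _; set g2 := fun h => h^-1 *: _.
    suff -> : g1 = g2 by []; apply/funext => h; rewrite /g1 /g2/=.
    by rewrite addr0 scale0r add0r [_%:A]mulr1.
  split=> -[fd <-].
    by apply: DeriveDef; [exact: (derivable1P f p v).1 | rewrite dE].
  by apply: DeriveDef; [exact: (derivable1P f p v).2 | rewrite dE].
move=> /lineE gd phid; apply/lineE.
by apply: is_derive1_comp; rewrite scale0r add0r.
Qed.

Lemma is_derive_cV (W : normedModType R) (f : W -> point) p v (d : point) :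
  (forall i, is_derive p v (fun q => f q i 0) (d i 0)) -> is_derive p v f d.
Proof.
move=> fd; have fdv : derivable f p v.
  by apply/derivable_mxP => i j; rewrite (ord1 j); have [] := fd i.
split=> //; rewrite derive_mx//; apply/matrixP => i j; rewrite !mxE (ord1 j).
by have [_ ->] := fd i.
Qed.

Section Derivatives.
Variables (W : normedModType R) (F : poly3).

Lemma is_derive_grad (x : W -> point) p v i : derivable x p v ->
  is_derive p v (fun q => grad F (x q) i 0) ((hess F (x p) *m 'D_v x p) i 0).
Proof.
move=> xd.
have -> : (fun q => grad F (x q) i 0) = (fun q => peval (mderiv i F) (x q)).
  by apply/funext => q; rewrite mxE.
apply: (is_derive_eq (is_derive_peval_dot (mderiv i F) xd)).
by rewrite dotE mulmx3E !mxE !(mderiv_comm i).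
Qed.

(** Leibniz rule for the relation that expresses the tangency of [f]. *)
Lemma dot_grad_derive (x f : W -> point) p v :
  derivable x p v -> derivable f p v ->
  (\forall q \near p, dot (grad F (x q)) (f q) = 0) ->
  dot (grad F (x p)) ('D_v f p) = - dot (hess F (x p) *m 'D_v x p) (f p).
Proof.
move=> xd fd nf; have dn i := is_derive_grad i xd.
have df i := is_derive_coord i fd.
have dnf : is_derive p v (fun q => dot (grad F (x q)) (f q))
    (dot (grad F (x p)) ('D_v f p) + dot (hess F (x p) *m 'D_v x p) (f p)).
  have -> : (fun q => dot (grad F (x q)) (f q)) = (fun q =>
      grad F (x q) 0 0 * f q 0 0 + grad F (x q) 1 0 * f q 1 0 +
      grad F (x q) 2 0 * f q 2 0) by apply/funext => q; rewrite dotE.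
  by apply: is_derive_eq; rewrite !dotE /GRing.scale/=; ring.
have [_] := dnf; rewrite (derive_locally_cst v nf) => /esym/eqP.
by rewrite addr_eq0 => /eqP.
Qed.

End Derivatives.


Section Patch.
Variables (F : poly3) (c : R) (U : set (R * R)) (x : R * R -> point).
Hypothesis Ux : regular_param U x.
Hypothesis level : forall q, U q -> peval F (x q) = c.

Local Notation n q := (grad F (x q)).
Local Notation H q := (hess F (x q)).
Local Notation B q := (peval (curvature_poly F) (x q)).

Let near_U p : U p -> \forall q \near p, U q.
Proof. by move=> Up; exact: (patch_nbhs Ux). Qed.

Lemma grad_tangent q : U q -> dot (n q) (Du x q) = 0 /\ dot (n q) (Dv x q) = 0.
Proof.
move=> Uq; apply: (dot_grad_patch Ux (c := c)) => //.
by apply: filterS (near_U Uq); exact: level.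
Qed.

(** The derivatives of [n . x_u = 0] and [n . x_v = 0] along the patch. *)
Lemma second_fundamental_form p : U p ->
  [/\ dot (n p) (Du (Du x) p) = - dot (H p *m Du x p) (Du x p),
      dot (n p) (Dv (Du x) p) = - dot (H p *m Dv x p) (Du x p) &
      dot (n p) (Dv (Dv x) p) = - dot (H p *m Dv x p) (Dv x p)].
Proof.
move=> Up; have [xu xv] := patch_derivable Ux Up.
have [[_ [Cu _ _]] [_ [Cv _ _]]] := patch_C2 Ux.
have [[xuu xuv] [xvu xvv]] := (Cu p Up, Cv p Up).
have tu : \forall q \near p, dot (n q) (Du x q) = 0.
  by apply: filterS (near_U Up) => q /grad_tangent[].
have tv : \forall q \near p, dot (n q) (Dv x q) = 0.
  by apply: filterS (near_U Up) => q /grad_tangent[].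
split.
- exact: (dot_grad_derive xu xuu tu).
- exact: (dot_grad_derive xv xuv tu).
- exact: (dot_grad_derive xv xvv tv).
Qed.

Lemma gauss_curvature_level p : U p -> n p != 0 ->
  gauss_curvature x p = B p / dot (n p) (n p) ^+ 2.
Proof.
move=> Up n0; have [nu nv] := grad_tangent Up.
have [E1 E2 E3] := second_fundamental_form Up.
rewrite peval_curvature_poly.
exact: (curvature_of_second_form n0 (patch_cross Ux Up) nu nv
  (hess_sym F (x p)) E1 E2 E3).
Qed.

Local Notation m q := (cross (Du x q) (Dv x q)).

Lemma affine_conormal_level q : U q -> n q != 0 -> affine_conormal x q =
  (Num.sg (dot (n q) (m q)) * `|B q| `^ (- 4^-1)) *: n q.
Proof.
move=> Uq n0; have [nu nv] := grad_tangent Uq.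
have nn := dot_self_gt0 n0; have m0 := patch_cross Ux Uq.
rewrite /affine_conormal gauss_curvature_level// powR_quarter// /unit_normal.
rewrite (unit_vector_collinear n0 m0 (normal_collinear n0 nu nv)) scalerA.
congr (_ *: _); have e0 : enorm (n q) != 0 by rewrite gt_eqF// sqrtr_gt0.
by rewrite -/(enorm (n q)) mulrC mulrA (mulrAC _ (enorm _)^-1) divfK.
Qed.

Hypothesis curved : forall q, U q -> gauss_curvature x q != 0.

Lemma curvature_poly_neq0 q : U q -> n q != 0 -> B q != 0.
Proof.
move=> Uq n0; have := curved Uq; rewrite gauss_curvature_level//.
by apply: contra_neq => ->; rewrite mul0r.
Qed.

(** The sign of the orientation and that of the curvature are locally constant,
    which makes the conormal differentiable in terms of [B] and [n]. *)
Lemma near_affine_conormal p : U p -> n p != 0 ->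
  exists s t : R, [/\ s != 0, 0 < t * B p & \forall q \near p,
    affine_conormal x q = (s * (t * B q) `^ (- 4^-1)) *: n q].
Proof.
move=> Up n0; have B0 := curvature_poly_neq0 Up n0.
have xc := patch_continuous Ux Up.
have nc i : continuous_at p (fun q => n q i 0).
  have -> : (fun q => n q i 0) = (fun q => peval (mderiv i F) (x q)).
    by apply/funext => q; rewrite mxE.
  exact: continuous_peval.
have mc i := @continuous_cross_patch R U x Ux p i Up.
have dc : continuous_at p (fun q => dot (n q) (m q)).
  have -> : (fun q => dot (n q) (m q)) = (fun q => n q 0 0 * m q 0 0 +
      n q 1 0 * m q 1 0 + n q 2 0 * m q 2 0) by apply/funext => q; rewrite dotE.
  exact: (continuousD (continuousD (continuousM (nc 0) (mc 0))
    (continuousM (nc 1) (mc 1))) (continuousM (nc 2) (mc 2))).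
have d0 : dot (n p) (m p) != 0.
  have [nu nv] := grad_tangent Up; apply: contra_neq (patch_cross Ux Up) => d0.
  by rewrite (normal_collinear n0 nu nv) d0 mul0r scale0r.
have n0i : exists i, n p i 0 != 0.
  apply: contrapT => nn; move/eqP: n0; apply; apply/matrixP => i j.
  rewrite (ord1 j) [RHS]mxE; apply: contrapT => ni.
  by apply: nn; exists i; exact/eqP.
have [i ni] := n0i.
exists (Num.sg (dot (n p) (m p))), (Num.sg (B p)); split.
- by rewrite sgr_eq0.
- by rewrite -normrEsg normr_gt0.
have Bc := @continuous_peval R _ x p (curvature_poly F) xc.
have Bq := near_sgr Bc B0; have dq := near_sgr dc d0.
have nq : \forall q \near p, n q i 0 != 0 by exact: cvgr_neq0 (nc i) ni.
near=> q.
have Uq : U q by near: q; exact: near_U.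
have nq0 : n q != 0.
  have : n q i 0 != 0 by near: q; exact: nq.
  by apply: contra_neq => ->; rewrite mxE.
rewrite affine_conormal_level// normrEsg.
have -> : Num.sg (B q) = Num.sg (B p) by near: q; exact: Bq.
have -> // : Num.sg (dot (n q) (m q)) = Num.sg (dot (n p) (m p)).
by near: q; exact: dq.
Unshelve. all: by end_near. Qed.

(** The factor between the conormal and the gradient is a function of the
    curvature polynomial alone. *)
Lemma derive_affine_conormal p : U p -> n p != 0 -> exists a b : R, b != 0 /\
  forall v : R * R, derivable x p v -> 'D_v (affine_conormal x) p =
    (a * dot (grad (curvature_poly F) (x p)) ('D_v x p)) *: n p +
    b *: (H p *m 'D_v x p).
Proof.
move=> Up n0; have [s [t [s0 tB nuE]]] := near_affine_conormal Up n0.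
exists (s * (- 4^-1 * (t * B p) `^ (- 4^-1 - 1) * t)).
exists (s * (t * B p) `^ (- 4^-1)).
split; first by rewrite mulf_neq0// gt_eqF// powR_gt0.
move=> v xd; rewrite (near_eq_derive v nuE).
have dB := is_derive_peval_dot (curvature_poly F) xd.
have dtB : is_derive p v (fun q => t * B q)
    (t * dot (grad (curvature_poly F) (x p)) ('D_v x p)).
  by apply: is_derive_eq; rewrite /GRing.scale/=; ring.
have dphi := is_derive_comp1 dtB (is_derive1_powR (- 4^-1) tB).
have [] // : is_derive p v (fun q => (s * (t * B q) `^ (- 4^-1)) *: n q)
  ((s * (- 4^-1 * (t * B p) `^ (- 4^-1 - 1) * t) *
     dot (grad (curvature_poly F) (x p)) ('D_v x p)) *: n p +
    (s * (t * B p) `^ (- 4^-1)) *: (H p *m 'D_v x p)).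
apply: is_derive_cV => i; have dn := is_derive_grad F i xd.
have -> : (fun q => ((s * (t * B q) `^ (- 4^-1)) *: n q) i 0) =
  (fun q => s * ((fun u : R => u `^ (- 4^-1)) \o (fun q => t * B q)) q *
    n q i 0).
  by apply/funext => q; rewrite mxE.
apply: is_derive_eq; rewrite /GRing.scale/=.
by rewrite [RHS]mxE [X in _ = X + _]mxE [X in _ = _ + X]mxE; ring.
Qed.

End Patch.

End LevelSurface.

(** * Affine normals of invariant level surfaces *)

(** Since [g . V = 0], the multiples of [n] cancel in the combination
    [a nu + b nv], which is therefore a multiple of [w]. *)
Lemma annihilator_of_conormals (K : realFieldType)
    (n g w u v V nu nv : 'cV[K]_3) (H : 'M[K]_3) (a b s t : K) :
  t != 0 -> V = a *: u + b *: v ->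
  dot g V = 0 -> H *m V = - w ->
  nu = (s * dot g u) *: n + t *: (H *m u) ->
  nv = (s * dot g v) *: n + t *: (H *m v) ->
  dot w (cross nu nv) = 0.
Proof.
move=> t0 -> gV HV nuE nvE.
have tE : t *: w = - (a *: nu + b *: nv).
  rewrite dotDr !dotZr in gV; rewrite mulmxDr -!scalemxAr in HV.
  rewrite -[w]opprK -HV scalerN nuE nvE; congr (- _).
  rewrite !scalerDr !scalerA addrACA -scalerDl (mulrCA a) (mulrCA b) -mulrDr gV.
  by rewrite mulr0 scale0r add0r (mulrC t) (mulrC t).
apply: (mulfI t0); rewrite mulr0 -dotZl tE dotNl dotDl !dotZl.
by rewrite !dot_cross_self !mulr0 addr0 oppr0.
Qed.

Section AffineNormalPlane.
Variable R : realType.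
Local Notation point := 'cV[R]_3.
Local Notation poly3 := (mpoly 3 R).
Variables (F : poly3) (C : 'M[R]_3) (Q alpha : point).
Hypothesis C_trace : C 0 0 + C 1 1 + C 2 2 = 0.
Hypothesis C_axis : C *m alpha = 0.
Hypothesis C_kernel : forall D, C *m D = 0 -> exists d, D = d *: alpha.
Hypothesis F_inv : lie C Q F = 0.

Lemma grad_field P : dot (grad F P) (C *m (P - Q)) = 0.
Proof. by rewrite -peval_lie F_inv peval0. Qed.

Lemma hess_field P : hess F P *m (C *m (P - Q)) = - (C^T *m grad F P).
Proof.
apply/matrixP => i j; rewrite (ord1 j).
have := congr1 (fun G => peval G P) (lie_mderiv F_inv i).
rewrite peval_lie dotE; move: (C *m _) => w.
rewrite pevalN sum3E !(pevalD, pevalM, pevalC) => E.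
rewrite mulmx3E [RHS]mxE mulmx3E !mxE; rewrite !mxE !(mderiv_comm i) in E.
by rewrite E.
Qed.

Lemma grad_curvature_field P :
  dot (grad (curvature_poly F) P) (C *m (P - Q)) = 0.
Proof. by rewrite -peval_lie lie_curvature_poly// peval0. Qed.

Variables (c : R) (U : set (R * R)) (x : R * R -> point) (p : R * R).
Hypothesis Ux : regular_param U x.
Hypothesis level : forall q, U q -> peval F (x q) = c.
Hypothesis curved : forall q, U q -> gauss_curvature x q != 0.
Hypothesis Up : U p.
Hypothesis regular : grad F (x p) != 0.

(** The linear part of the field carries the conormal along the orbits, so the
    derivative of the conormal in the direction of the field is a multiple of
    [C^T n]. The affine normal is orthogonal to all these derivatives. *)
Lemma affine_normal_annihilator :
  dot (C^T *m grad F (x p)) (affine_normal x p) = 0.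
Proof.
have [nu nv] := grad_tangent Ux level Up.
have [xu xv] := patch_derivable Ux Up.
have [a [b VE]] := tangent_decomposition regular (patch_cross Ux Up) nu nv
  (grad_field (x p)).
have [s [t [t0 dnu]]] := derive_affine_conormal Ux level curved Up regular.
have := dnu _ xu; have := dnu _ xv; rewrite -/(Du x p) -/(Dv x p).
rewrite -/(Du (affine_conormal x) p) -/(Dv (affine_conormal x) p).
rewrite /affine_normal; move: (Du _ p) (Dv _ p) => nu_u nu_v.
move=> nvE nuE; rewrite dotZr.
rewrite (annihilator_of_conormals t0 VE (grad_curvature_field _)
  (hess_field _) nuE nvE).
by rewrite mulr0.
Qed.

(** The annihilator [C^T n] is orthogonal to the axis, to [x p - Q] and to the
    affine normal. It only vanishes on the axis, since otherwise the field
    would be a degenerate direction of the second fundamental form. *)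
Lemma affine_normal_meets_axis :
  dot alpha (cross (x p - Q) (affine_normal x p)) = 0.
Proof.
have wxi := affine_normal_annihilator.
have wa : dot (C^T *m grad F (x p)) alpha = 0 by rewrite dot_trmx C_axis dot0r.
have wD : dot (C^T *m grad F (x p)) (x p - Q) = 0.
  by rewrite dot_trmx grad_field.
have [w0|w0] := eqVneq (C^T *m grad F (x p)) 0; last first.
  exact: (coplanar_of_orthogonal w0 wa wD wxi).
have [nu nv] := grad_tangent Ux level Up.
have m0 := patch_cross Ux Up.
have [a [b VE]] := tangent_decomposition regular m0 nu nv (grad_field (x p)).
have HV := hess_field (x p); rewrite w0 oppr0 VE in HV.
have Bm : adjugate_form_mx (cross (Du x p) (Dv x p)) (hess F (x p)) != 0.
  rewrite (normal_collinear regular nu nv) adjugate_formZ mulf_neq0//.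
    rewrite sqrf_eq0; apply: contra_neq m0 => k0.
    by rewrite (normal_collinear regular nu nv) k0 scale0r.
  by rewrite -peval_curvature_poly (curvature_poly_neq0 Ux level curved).
have [a0 b0] := adjugate_form_degenerate (hess_sym F (x p)) Bm HV.
have [|d ->] := C_kernel (D := x p - Q).
  by rewrite VE a0 b0 !scale0r addr0.
by rewrite dotE !crossE !mxE; ring.
Qed.

End AffineNormalPlane.

(** * The axis of an affine rotation surface *)

Section Axis.
Variable R : realType.
Local Notation point := 'cV[R]_3.
Local Notation poly3 := (mpoly 3 R).
Local Notation e3 := (vec3 0 0 1 : point).

(** An affine frame [(Q, M)] with origin on the axis in which the group is
    canonical, so that the translation part of the rigid motion disappears. *)
Lemma canonical_frame (S A : set point) (alpha beta : point) :
  affine_rotation_surface S A -> plucker A beta alpha ->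
  exists G Ag M Q r, [/\ canonical_group G Ag, M^T *m M = 1%:M,
    r != 0 /\ M *m alpha = r *: e3, beta = cross Q alpha &
    forall P t, S P -> S (orbit_curve G M Q (M *m (P - Q)) t)].
Proof.
move=> [T [[M [b [MM TE]]] TA Sinv]] [a0 [Q [AE bE]]].
have zaxis s : exists d, T (Q + s *: alpha) = d *: e3.
  have : z_axis (T (Q + s *: alpha)).
    by rewrite -TA; exists (Q + s *: alpha) => //; rewrite AE; exists s.
  by move=> [d _ <-]; exists d; rewrite add0r.
have [z TQ] := zaxis 0; have [z' TQa] := zaxis 1.
rewrite scale0r addr0 in TQ; rewrite scale1r in TQa.
have Ma : M *m alpha = (z' - z) *: e3.
  rewrite scalerBl -TQ -TQa !TE mulmxDr opprD addrACA subrr addr0.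
  by rewrite addrAC subrr add0r.
have [G [Ag [GA Ginv]]] : exists G Ag,
    canonical_group G Ag /\ invariant_under G (T @` S).
  case: Sinv => Sinv.
  - by exists (@elliptic R), (elliptic_gen R); split; [exact: Elliptic|].
  - by exists (@hyperbolic R), (hyperbolic_gen R); split; [exact: Hyperbolic|].
  - by exists (@parabolic R), (parabolic_gen R); split; [exact: Parabolic|].
exists G, Ag, M, Q, (z' - z); split=> //.
  split=> //; apply: contraNneq a0 => z0.
  by rewrite -[alpha]mul1mx -MM -mulmxA Ma z0 scale0r mulmx0.
move=> P t SP.
have : (T @` S) (G t *m T P).
  by rewrite -[X in X (_ *m _)](Ginv t); exists (T P) => //; exists P.
move=> [P' SP' TP'].
suff <- : P' = orbit_curve G M Q (M *m (P - Q)) t by [].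
have E : M *m (P' - Q) = G t *m (M *m (P - Q)).
  have -> : M *m (P' - Q) = T P' - T Q.
    by rewrite !TE mulmxBr opprD addrACA subrr addr0.
  have -> : M *m (P - Q) = T P - T Q.
    by rewrite !TE mulmxBr opprD addrACA subrr addr0.
  by rewrite TP' mulmxBr TQ -scalemxAr (canonical_group_axis GA).
by rewrite /orbit_curve -E mulmxA MM mul1mx addrC subrK.
Qed.

Variables (G : R -> 'M[R]_3) (Ag M : 'M[R]_3) (r : R) (alpha : point).
Hypothesis GA : canonical_group G Ag.
Hypothesis MM : M^T *m M = 1%:M.
Hypothesis r0 : r != 0.
Hypothesis Ma : M *m alpha = r *: e3.

Local Notation C := (M^T *m Ag *m M).

Lemma conjugate_trace : C 0 0 + C 1 1 + C 2 2 = 0.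
Proof.
rewrite -(sum3E (fun i => C i i)) -[LHS]/(\tr C) -mulmxA mxtrace_mulC.
rewrite -mulmxA (mulmx1C MM) mulmx1 /mxtrace sum3E.
exact: (generator_trace GA).
Qed.

Lemma conjugate_axis : C *m alpha = 0.
Proof.
by rewrite -mulmxA Ma -mulmxA -scalemxAr (generator_axis GA) scaler0 mulmx0.
Qed.

Lemma conjugate_kernel D : C *m D = 0 -> exists d, D = d *: alpha.
Proof.
move=> /(congr1 (mulmx M)); rewrite !mulmxA (mulmx1C MM) mul1mx mulmx0 -mulmxA.
move=> /(generator_kernel GA); set d := (M *m D) 2 0 => MD.
exists (d / r); rewrite -[D]mul1mx -MM -mulmxA MD -[alpha]mul1mx -MM -mulmxA Ma.
by rewrite -!scalemxAr scalerA divfK.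
Qed.

End Axis.

Section Invariance.
Variable R : realType.
Local Notation point := 'cV[R]_3.
Local Notation poly3 := (mpoly 3 R).

Lemma irreducible_nonconstant (F : poly3) : irreducible_elt F ->
  exists i, mderiv i F != 0.
Proof.
move=> [F0 FNu _]; apply: contrapT => nd.
have FE : F = mpolyC 3 (mcoeff mnm0 F).
  apply: mderiv_eq0_const => i; apply: contrapT => di; apply: nd.
  by exists i; apply/eqP.
move: (mcoeff mnm0 F) FE => c FE; subst F.
have c0 : c != 0 by apply: contra_neq F0 => ->; rewrite mpolyC0.
by move: FNu; rewrite (rmorph_unit (@mpolyC 3 R)) ?unitfE.
Qed.

(** A polynomial of degree one defines a plane. *)
Lemma curved_second_derivatives (F : poly3) : irreducible_elt F ->
  curvature_not_identically_zero (zero_set F) ->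
  ~ forall i j, mderiv i (mderiv j F) = 0.
Proof.
move=> irrF [U [x [p [Ux xS Up K0]]]] dd.
have n0 : grad F (x p) != 0.
  have [i di] := irreducible_nonconstant irrF.
  have diE := mderiv_eq0_const (dd ^~ i).
  apply: contra_neq di => /matrixP/(_ i 0); rewrite !mxE diE pevalC => ->.
  by rewrite mpolyC0.
have lev q : U q -> peval F (x q) = 0 by move=> Uq; apply: xS; exists q.
move/eqP: K0; apply; rewrite (gauss_curvature_level Ux lev Up n0).
have -> : curvature_poly F = 0.
  by rewrite /curvature_poly /adjugate_form !dd !(mulr0, mul0r, subr0, addr0).
by rewrite peval0 mul0r.
Qed.

(** The field multiplies [F] by a constant, which is zero for each of the three
    groups; in the hyperbolic case the zero set would otherwise be a plane. *)
Lemma invariant_polynomial (G : R -> 'M[R]_3) (Ag M : 'M[R]_3) (Q : point)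
    (F : poly3) :
  canonical_group G Ag -> M^T *m M = 1%:M -> irreducible_elt F ->
  two_dimensional (zero_set F) ->
  curvature_not_identically_zero (zero_set F) ->
  (forall P t, zero_set F P ->
     zero_set F (orbit_curve G M Q (M *m (P - Q)) t)) ->
  lie (M^T *m Ag *m M) Q F = 0.
Proof.
move=> GA MM irrF [patch _] Scurv Sorb; have [F0 _ _] := irrF.
have [||lambda FE] :=
  lie_eigenvector (C := M^T *m Ag *m M) (Q := Q) irrF patch _ _.
- by [].
- move=> P SP.
  have := is_derive_peval F (is_derive_orbit_curve GA M Q (M *m (P - Q)) 0).
  rewrite -[\sum_i _]/(dot _ _) (orbit_curve_start Q GA MM).
  rewrite (canonical_group0 GA) mul1mx !mulmxA => -[_ <-].
  apply: (@derive_locally_cst _ _ _ _ _ 0).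
  by apply: filterE => t; exact: Sorb.
suff l0 : lambda = 0 by rewrite FE l0 mpolyC0 mul0r.
have [Ge|Gh|Gp] : [\/ G = @elliptic R, G = @hyperbolic R | G = @parabolic R].
  by case: GA; [constructor 1|constructor 2|constructor 3].
- exact: (eigenvalue0_elliptic GA MM FE F0 Ge).
- apply/eqP; apply: contraT => l0.
  have [w w0 Fw] := eigenvalue_hyperbolic GA MM FE Gh l0.
  case: (curved_second_derivatives irrF Scurv).
  exact: (irreducible_vanishing_on_plane w0 irrF Fw).
- exact: (eigenvalue0_parabolic GA MM FE F0 Gp).
Qed.

End Invariance.

(** * The axis condition on the affine normals *)

Section Generic.
Variable R : realType.
Local Notation point := 'cV[R]_3.
Local Notation poly3 := (mpoly 3 R).

Lemma generic_eq0 (D N : poly3) : D != 0 ->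
  (forall P : point, peval D P != 0 -> peval N P = 0) -> N = 0.
Proof.
move=> D0 DN; have : D * N = 0.
  apply: peval_eq0 => P; rewrite pevalM.
  by have [->|/DN ->] := eqVneq (peval D P) 0; rewrite ?mul0r ?mulr0.
by move/eqP; rewrite mulf_eq0 (negbTE D0) => /eqP.
Qed.

Lemma rat_value_fraction (p q : poly3) (P : point) c : q != 0 ->
  rat_value (tofrac p / tofrac q) P c -> c * peval q P = peval p P.
Proof.
move=> q0 [p' [q' [E q'P ->]]].
have q'0 : q' != 0 by apply: contra_neq q'P => ->; rewrite peval0.
have : p * q' == p' * q.
  by rewrite -tofrac_eq !tofracM -eqr_div ?tofrac_eq0// E.
move=> /eqP/(congr1 (fun f => peval f P)); rewrite !pevalM => pq.
by rewrite mulrAC -pq mulfK.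
Qed.

End Generic.

Section AxisForm.
Variable K : comNzRingType.
Implicit Types a b P g : 'cV[K]_3.

Definition axis_form a b P g : K := dot a (cross P g) + dot b g.

Lemma axis_formE a b P g : axis_form a b P g =
  a 0 0 * (P 1 0 * g 2 0 - P 2 0 * g 1 0)
  + a 1 0 * (- P 0 0 * g 2 0 + P 2 0 * g 0 0)
  + a 2 0 * (P 0 0 * g 1 0 - P 1 0 * g 0 0)
  + b 0 0 * g 0 0 + b 1 0 * g 1 0 + b 2 0 * g 2 0.
Proof. by rewrite /axis_form !dotE !crossE; ring. Qed.

Lemma axis_formZ a b P g k : axis_form a b P (k *: g) = k * axis_form a b P g.
Proof. by rewrite !axis_formE !mxE; ring. Qed.

(** A line through [P] of direction [g] meets, or is parallel to, the line of
    direction [a] through [Q] when [a], [P - Q] and [g] are coplanar. *)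
Lemma axis_form_plucker a Q P g :
  axis_form a (cross Q a) P g = dot a (cross (P - Q) g).
Proof. by rewrite axis_formE dotE !crossE !mxE; ring. Qed.

End AxisForm.

Lemma axis_form_map (K L : comNzRingType) (f : {rmorphism K -> L})
    (a b P g : 'cV[K]_3) :
  f (axis_form a b P g) =
  axis_form (map_mx f a) (map_mx f b) (map_mx f P) (map_mx f g).
Proof. by rewrite !axis_formE !(rmorphD, rmorphB, rmorphM, rmorphN) !mxE. Qed.

Section ClearDenominators.
Variable K : fieldType.

Lemma clear_denominator0 (p q r s : K) : q != 0 ->
  q * r * s * (p / q) = p * (r * s).
Proof. by move=> q0; field. Qed.

Lemma clear_denominator1 (p q r s : K) : q != 0 ->
  r * q * s * (p / q) = p * (r * s).
Proof. by move=> q0; field. Qed.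

Lemma clear_denominator2 (p q r s : K) : q != 0 ->
  r * s * q * (p / q) = p * (r * s).
Proof. by move=> q0; field. Qed.

End ClearDenominators.

Theorem theorem19 (R : realType) (F : mpoly 3 R) (A : set 'cV[R]_3)
    (alpha beta : 'cV[R]_3) (gamma : 'cV[{fraction (mpoly 3 R)}]_3)
    (F_irr : irreducible_elt F)
    (S_dim2 : two_dimensional (zero_set F))
    (S_curv : curvature_not_identically_zero (zero_set F))
    (S_rot : affine_rotation_surface (zero_set F) A)
    (A_plucker : plucker A beta alpha)
    (gamma_normal : affine_normal_direction F gamma) :
  let P : 'cV[{fraction (mpoly 3 R)}]_3 := xyz R in
  let x := P 0 0 in let y := P 1 0 in let z := P 2 0 in
  let a := const_vec alpha in
  let b := const_vec beta in
  let a1 := a 0 0 in let a2 := a 1 0 in let a3 := a 2 0 in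
  let b1 := b 0 0 in let b2 := b 1 0 in let b3 := b 2 0 in
  let g1 := gamma 0 0 in let g2 := gamma 1 0 in let g3 := gamma 2 0 in
  dot a (cross P gamma) + dot b gamma =
    a1 * (y * g3 - z * g2) + a2 * (- x * g3 + z * g1) + a3 * (x * g2 - y * g1)
      + b1 * g1 + b2 * g2 + b3 * g3 /\
  dot a (cross P gamma) + dot b gamma = 0.
Proof.
move=> P x y z a b a1 a2 a3 b1 b2 b3 g1 g2 g3.
split; first exact: axis_formE.
have [G [Ag [M [Q [r [GA MM [r0 Ma] bE Sorb]]]]]] :=
  canonical_frame S_rot A_plucker.
have F_inv := invariant_polynomial GA MM F_irr S_dim2 S_curv Sorb.
have [D [D0 Dgen]] := gamma_normal.
have [i0 dF0] := irreducible_nonconstant F_irr.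
(* The value of [gamma i 0] at one generic point provides a global fraction. *)
have frac i : exists pq : mpoly 3 R * mpoly 3 R,
    pq.2 != 0 /\ gamma i 0 = tofrac pq.1 / tofrac pq.2.
  have [P0 DP0] : exists P0, peval D P0 != 0.
    apply: contrapT => nP; move/eqP: D0; apply; apply: peval_eq0 => P0.
    by apply: contrapT => DP; apply: nP; exists P0; exact/eqP.
  have [xi [gP [c [_ gPE _ _]]]] := Dgen _ DP0.
  have [p [q [-> qP _]]] := gPE i; exists (p, q); split=> //=.
  by apply: contra_neq qP => ->; rewrite peval0.
have [pq pqE] := choice frac.
pose den := (pq 0).2 * (pq 1).2 * (pq 2).2.
pose g : 'cV[mpoly 3 R]_3 := vec3 ((pq 0).1 * ((pq 1).2 * (pq 2).2))
  ((pq 1).1 * ((pq 0).2 * (pq 2).2)) ((pq 2).1 * ((pq 0).2 * (pq 1).2)).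
have [[[q0 gam0] [q1 gam1]] [q2 gam2]] := (pqE 0, pqE 1, pqE 2).
have den0 : den != 0 by rewrite !mulf_neq0.
have gden : tofrac den *: gamma = map_mx (@tofrac (mpoly 3 R)) g.
  apply: cV3P; rewrite !mxE/= !tofracM.
  - by rewrite gam0 clear_denominator0// tofrac_eq0.
  - by rewrite gam1 clear_denominator1// tofrac_eq0.
  - by rewrite gam2 clear_denominator2// tofrac_eq0.
pose a' : 'cV[mpoly 3 R]_3 := map_mx (@mpolyC 3 R) alpha.
pose b' : 'cV[mpoly 3 R]_3 := map_mx (@mpolyC 3 R) beta.
pose X : 'cV[mpoly 3 R]_3 := \col_i mpolyX R (mnm1 i).
(* The numerator of the identity over the common denominator [den]. *)
pose N := axis_form a' b' X g.
have NE : tofrac den * axis_form a b P gamma = tofrac N.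
  rewrite axis_form_map -gden -axis_formZ; congr axis_form.
  - by apply/matrixP => i j; rewrite !mxE (ord1 j).
  - by apply/matrixP => i j; rewrite !mxE (ord1 j).
  - by apply/matrixP => i j; rewrite !mxE.
suff N0 : N = 0.
  apply/eqP; move/eqP: NE; rewrite N0 tofrac0 mulf_eq0 tofrac_eq0 (negbTE den0).
  by [].
(* Generic points are also taken outside the zero set of a partial derivative,
   so that the gradient does not vanish there. *)
apply: (@generic_eq0 R (D * mderiv i0 F)); first by rewrite mulf_neq0.
move=> P1; rewrite pevalM mulf_eq0 => /norP[DP1 dP1].
have [xi [gP [c [xiN gPE c0 xiE]]]] := Dgen _ DP1.
have gP_den : peval den P1 *: gP = map_mx (fun f => peval f P1) g.
  have v0 := gPE 0; have v1 := gPE 1; have v2 := gPE 2.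
  rewrite gam0 in v0; rewrite gam1 in v1; rewrite gam2 in v2.
  move/(rat_value_fraction q0): v0 => v0.
  move/(rat_value_fraction q1): v1 => v1.
  move/(rat_value_fraction q2): v2 => v2.
  apply: cV3P; rewrite !mxE/= !pevalM -?v0 -?v1 -?v2; ring.
have NP : peval N P1 = peval den P1 * axis_form alpha beta P1 gP.
  rewrite -axis_formZ gP_den.
  rewrite -[LHS]/(meval (fun i => P1 i 0) N) axis_form_map; congr axis_form.
  - by apply/matrixP => i j; rewrite !mxE; exact: mevalC.
  - by apply/matrixP => i j; rewrite !mxE; exact: mevalC.
  - by apply/matrixP => i j; rewrite !mxE (ord1 j); exact: mevalXU.
rewrite NP bE axis_form_plucker.
have [U [u [p [Ux uS K0 [Up uP] xiU]]]] := xiN.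
have reg : grad F (u p) != 0.
  by rewrite uP; apply: contra_neq dP1 => /matrixP/(_ i0 0); rewrite !mxE.
have lev q : U q -> peval F (u q) = peval F P1.
  by move=> Uq; apply: uS; exists q.
have := affine_normal_meets_axis (conjugate_trace GA MM) (conjugate_axis GA Ma)
  (conjugate_kernel GA MM r0 Ma) F_inv Ux lev K0 Up reg.
rewrite uP -xiU xiE.
have -> : dot alpha (cross (P1 - Q) (c *: gP)) =
    c * dot alpha (cross (P1 - Q) gP).
  by rewrite !dotE !crossE !mxE; ring.
by move/eqP; rewrite mulf_eq0 (negbTE c0) => /eqP ->; rewrite mulr0.
Qed.
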